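(* Let $w\in\mathbb R^n$ be an $L$-generic direction and choose a reference vector $\lambda_\Lambda\in\Lambda$ for every $\Lambda\in\mathfrak L^{\mathrm{adm}}_{\beta,w}$; put $\lambda=(\lambda_\Lambda)_\Lambda$. For every $\Lambda\in\mathfrak L^{\mathrm{adm}}_{\beta,w}$, the map $$\mathrm{Ser}^{\lambda_\Lambda}_{\Lambda,w}:\mathrm{Hom}_S\bigl(M^{\mathrm{dir}}_{\Lambda,w},\mathbb C[y]\bigr)\longrightarrow\mathrm{Sol}^{\mathrm{dir}}_{w,\Lambda}(H_A(\beta))$$ is a linear isomorphism, and the finite direct sum $\mathrm{Ser}^{\lambda}_{\beta,w}=\bigoplus_{\Lambda\in\mathfrak L^{\mathrm{adm}}_{\beta,w}}\mathrm{Ser}^{\lambda_\Lambda}_{\Lambda,w}$ is a linear isomorphism $$\mathrm{Hom}_S\bigl(M^{\mathrm{dir,all}}_{\beta,w},\mathbb C[y]\bigr)\xrightarrow{\ \sim\ }\mathrm{Sol}^{\mathrm{dir,all}}_{\beta,w}(H_A(\beta)).$$ Explicitly, let $(c_{\Lambda,I})_{I\in\mathrm{NS}(\Lambda)}$ be the normalized coefficient family corresponding to a homomorphism $\psi\in\mathrm{Hom}_S(M^{\mathrm{dir}}_{\Lambda,w},\mathbb C[y])$, i.e. $c_{\Lambda,I}=\psi(\overline e^*_{\Lambda,I})$. For $\gamma\in\Lambda_I$ define $$r^{(\lambda_\Lambda)}_{\Lambda,\gamma}=(\widetilde d_{\lambda_\Lambda\leftarrow\gamma}\bullet)^{-1}\bigl(\widetilde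 d_{\gamma\leftarrow\lambda_\Lambda}\bullet c_{\Lambda,I}\bigr).$$ Then the corresponding classwise solution is $$\varphi_\Lambda=\sum_{\gamma\in\Lambda}x^\gamma\,r^{(\lambda_\Lambda)}_{\Lambda,\gamma}(\log x).$$
   Context: Basics. $\mathbb N=\{0,1,2,\dots\}$, $[n]=\{1,\dots,n\}$. $A=(a_{ij})\in\mathrm{Mat}_{d\times n}(\mathbb Z)$ has rank $d$, $\beta\in\mathbb C^d$, $L=\mathrm{Ker}_{\mathbb Z}(A)$. An exponent lattice is a coset $\Lambda=\lambda+L$ with $\lambda\in\mathbb C^n$, $A\lambda=\beta$; $\mathfrak L_\beta$ is the set of all of them. Hypergeometric ideal. $D=\mathbb C\langle x_1,\dots,x_n,\partial_{x_1},\dots,\partial_{x_n}\rangle$ is the Weyl algebra, $\theta_{x_j}=x_j\partial_{x_j}$, $(A\theta_x)_i=\sum_ja_{ij}\theta_{x_j}$. For $u\in\mathbb Z^n$ write $u=u_+-u_-$ with $u_\pm\in\mathbb N^n$ of disjoint support. $I_A=\langle\partial_x^{u_+}-\partial_x^{u_-}\mid u\in L\rangle\subset\mathbb C[\partial_x]$, $H_A(\beta)=DI_A+\sum_{i=1}^dD((A\theta_x)_i-\beta_i)$. Formal series. $S=\mathbb C[\partial_{y_1},\dots,\partial_{y_n}]$ acts on $\mathbb C[y]$ by differentiation, written $\bullet$; $(A\partial_y)_i=\sum_ja_{ij}\partial_{y_j}$; $\partial_y^K=\prod_{j\in K}\partial_{y_j}$. $\widetilde\Lambda=\Lambda+\mathbb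 Z^n$. $\mathscr F^{\log}_{\widetilde\Lambda}$ is the space of all formal (possibly infinite) sums $\sum_{\gamma\in\widetilde\Lambda}x^\gamma p_\gamma(\log x)$, $p_\gamma\in\mathbb C[y]$, with coefficientwise equality, on which $D$ acts coefficientwise by $x_j\bullet(x^\gamma p(\log x))=x^{\gamma+e_j}p(\log x)$, $\partial_{x_j}\bullet(x^\gamma p(\log x))=x^{\gamma-e_j}((\gamma_j+\partial_{y_j})\bullet p)(\log x)$. $\mathrm{Supp}(\varphi)=\{\gamma\mid p_\gamma\ne0\}$. Supports and direction. $\mathrm{nsupp}(\gamma)=\{j\in[n]\mid\gamma_j\in\mathbb Z_{<0}\}$; $\Lambda_I=\{\gamma\in\Lambda\mid\mathrm{nsupp}(\gamma)=I\}$; $\mathrm{NS}(\Lambda)=\{I\mid\Lambda_I\ne\emptyset\}$; $\mathrm{MinNS}(\Lambda)$ is the set of inclusion-minimal elements of $\mathrm{NS}(\Lambda)$. $w$ is $L$-generic if $w\cdot u\ne0$ for all $u\in L\setminus\{0\}$. On $\Lambda$, $\gamma\le_w\gamma'$ iff $w\cdot(\gamma'-\gamma)\ge0$ (a total order). $\mathcal B_w(\Lambda)$ is the set of $I\in\mathrm{NS}(\Lambda)$ such that $\{w\cdot(\gamma-\lambda)\mid\gamma\in\Lambda_I\}$ is bounded below in $\mathbb R$ (for one, equivalently any, $\lambda\in\Lambda$). $\mathcal M_w(\Lambda)=\mathrm{MinNS}(\Lambda)\cap\mathcal B_w(\Lambda)$; $\mathfrak L^{\mathrm{adm}}_{\beta,w}=\{\Lambda\in\mathfrak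 L_\beta\mid\mathcal M_w(\Lambda)\ne\emptyset\}$ (a finite set). $\mathcal A_w(\Lambda)$ is the set of $I\in\mathrm{NS}(\Lambda)$ such that every $J\in\mathrm{NS}(\Lambda)$ with $J\subset I$ lies in $\mathcal B_w(\Lambda)$. Solutions. $\mathrm{Sol}^{\mathrm{dir}}_{w,\Lambda}(H_A(\beta))$ is the set of $\varphi\in\mathscr F^{\log}_{\widetilde\Lambda}$ with $\mathrm{Supp}(\varphi)\subset\Lambda$ and $H_A(\beta)\bullet\varphi=0$ such that $\varphi=0$ or $\mathrm{Supp}(\varphi)$ has a $\le_w$-minimum. $\mathrm{Sol}^{\mathrm{dir,all}}_{\beta,w}(H_A(\beta))=\bigoplus_{\Lambda\in\mathfrak L_\beta}\mathrm{Sol}^{\mathrm{dir}}_{w,\Lambda}(H_A(\beta))$. Transit operators. For $\alpha\in\mathbb C^n$, $\nu\in\mathbb N^n$: $[\partial_y+\alpha]_\nu=\prod_{j=1}^n\prod_{k=0}^{\nu_j-1}(\partial_{y_j}+\alpha_j-k)$. For $\gamma,\gamma'\in\Lambda$: $d_{\gamma'\leftarrow\gamma}=[\partial_y+\gamma]_{(\gamma-\gamma')_+}\in S$, which is divisible in $S$ by $\partial_y^{\mathrm{nsupp}(\gamma')\setminus\mathrm{nsupp}(\gamma)}$, and $\widetilde d_{\gamma'\leftarrow\gamma}=d_{\gamma'\leftarrow\gamma}/\partial_y^{\mathrm{nsupp}(\gamma')\setminus\mathrm{nsupp}(\gamma)}$, which acts bijectively on $\mathbb C[y]$. Module and map. $M^{\mathrm{dir}}_{\Lambda,w}$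 is the quotient of the free $S$-module $\bigoplus_{I\in\mathrm{NS}(\Lambda)}Se^*_{\Lambda,I}$ by the submodule generated by all $(A\partial_y)_ie^*_{\Lambda,I}$, all $\partial_y^{J\setminus I}e^*_{\Lambda,I}-\partial_y^{I\setminus J}e^*_{\Lambda,J}$ ($I,J\in\mathrm{NS}(\Lambda)$), and all $e^*_{\Lambda,K}$ with $K\in\mathrm{NS}(\Lambda)\setminus\mathcal A_w(\Lambda)$; $\overline e^*_{\Lambda,I}$ is the class of $e^*_{\Lambda,I}$. $M^{\mathrm{dir,all}}_{\beta,w}=\bigoplus_{\Lambda\in\mathfrak L_\beta}M^{\mathrm{dir}}_{\Lambda,w}$; its summands with $\Lambda\notin\mathfrak L^{\mathrm{adm}}_{\beta,w}$ vanish, so $\mathrm{Hom}_S(M^{\mathrm{dir,all}}_{\beta,w},\mathbb C[y])$ is identified with $\bigoplus_{\Lambda\in\mathfrak L^{\mathrm{adm}}_{\beta,w}}\mathrm{Hom}_S(M^{\mathrm{dir}}_{\Lambda,w},\mathbb C[y])$. The map $\mathrm{Ser}^{\lambda_\Lambda}_{\Lambda,w}$ sends $\psi$ to the series obtained from the family $c_{\Lambda,I}=\psi(\overline e^*_{\Lambda,I})$ by the inverse normalization $r_\gamma=(\widetilde d_{\lambda_\Lambda\leftarrow\gamma}\bullet)^{-1}(\widetilde d_{\gamma\leftarrow\lambda_\Lambda}\bullet c_{\Lambda,\mathrm{nsupp}(\gamma)})$, followed by $(r_\gamma)_{\gamma\in\Lambda}\mapsto\sum_{\gamma\in\Lambda}x^\gamma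 r_\gamma(\log x)$. *)

(* Defs.v *)
From HB Require Import structures.
From mathcomp Require Import all_boot all_order all_algebra.
From mathcomp Require Import boolp classical_sets functions cardinality.
From mathcomp Require Import reals complex.
From mathcomp Require Import finmap ssrcomplements monalg mpoly.

Set Implicit Arguments.
Unset Strict Implicit.
Unset Printing Implicit Defensive.

Import Order.TTheory GRing.Theory Num.Theory.

Local Open Scope classical_set_scope.
Local Open Scope ring_scope.
Local Open Scope quotient_scope.

(* [monalg] and [mpoly] both define this notation; we use that of [mpoly]. *)
Local Notation "{ 'mpoly' R [ n ] }" := (mpoly.mpoly n R) : type_scope.

Section Span.
Variables (R : pzRingType) (V : lmodType R) (G : set V).

Definition span : set V :=
  [set v | exists2 s : seq (R * V),
     (forall p, p \in s -> G p.2) & v = \sum_(p <- s) p.1 *: p.2].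

Lemma span0 : span 0.
Proof. by exists [::] => //; rewrite big_nil. Qed.

Lemma spanD u v : span u -> span v -> span (u + v).
Proof.
move=> [s sG ->] [t tG ->]; exists (s ++ t); last by rewrite big_cat.
by move=> p; rewrite mem_cat => /orP[/sG|/tG].
Qed.

Lemma spanZ a v : span v -> span (a *: v).
Proof.
move=> [s sG ->]; exists [seq (a * p.1, p.2) | p <- s].
  by move=> _ /mapP[p ps ->]; exact: (sG _ ps).
by rewrite big_map scaler_sumr; apply: eq_bigr => p _; rewrite scalerA.
Qed.

Lemma span_gen v : G v -> span v.
Proof.
move=> Gv; exists [:: (1, v)]; last by rewrite big_seq1 scale1r.
by move=> p; rewrite mem_seq1 => /eqP -> /=.
Qed.

Definition span_pred : {pred V} := fun v => `[< span v >].

Lemma span_zmod_closed : zmod_closed span_pred.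
Proof.
split; first exact/asboolP/span0.
move=> u v /asboolP su /asboolP sv; apply/asboolP.
by rewrite -scaleN1r; apply: spanD => //; exact: spanZ.
Qed.

HB.instance Definition _ := GRing.isZmodClosed.Build V span_pred span_zmod_closed.

Definition quot_mod := Quotient.quot span_pred.

HB.instance Definition _ := GRing.Zmodule.on quot_mod.
HB.instance Definition _ := EqQuotient.on quot_mod.

Definition quot_class (v : V) : quot_mod := \pi v.

Definition quot_scale (a : R) (q : quot_mod) : quot_mod :=
  quot_class (a *: repr q).

Lemma quot_classE u v : (quot_class u = quot_class v) <-> span (u - v).
Proof.
rewrite /quot_class; split.
  by move=> /eqP; rewrite -Quotient.idealrBE => /asboolP.
by move=> /asboolP h; apply/eqP; rewrite -Quotient.idealrBE.
Qed.

Lemma quot_classB : zmod_morphism quot_class.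
Proof. by move=> u v; rewrite /quot_class raddfB. Qed.

Lemma quot_class_surj (q : quot_mod) : quot_class (repr q) = q.
Proof. exact: reprK. Qed.

Lemma quot_scaleE a v : quot_scale a (quot_class v) = quot_class (a *: v).
Proof.
apply/quot_classE; rewrite -scalerBr; apply: spanZ.
by apply/quot_classE; rewrite quot_class_surj.
Qed.

HB.instance Definition _ :=
  GRing.isZmodMorphism.Build V quot_mod quot_class quot_classB.

Lemma quot_scaleA a b q : quot_scale a (quot_scale b q) = quot_scale (a * b) q.
Proof. by rewrite -(quot_class_surj q) !quot_scaleE scalerA. Qed.

Lemma quot_scale1 : left_id 1 quot_scale.
Proof. by move=> q; rewrite -(quot_class_surj q) quot_scaleE scale1r. Qed.

Lemma quot_scaleDr : right_distributive quot_scale +%R.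
Proof.
move=> a q r; rewrite -(quot_class_surj q) -(quot_class_surj r).
by rewrite -raddfD !quot_scaleE scalerDr raddfD.
Qed.

Lemma quot_scaleDl q : {morph quot_scale^~ q : a b / a + b}.
Proof.
by move=> a b; rewrite -(quot_class_surj q) !quot_scaleE scalerDl raddfD.
Qed.

HB.instance Definition _ := GRing.Zmodule_isLmodule.Build R quot_mod
  quot_scaleA quot_scale1 quot_scaleDr quot_scaleDl.

Lemma quot_class_scalable : scalable quot_class.
Proof. by move=> a v; rewrite -quot_scaleE. Qed.

HB.instance Definition _ :=
  GRing.isScalable.Build R V quot_mod *:%R quot_class quot_class_scalable.

End Span.

Section DirectSum.
Variables (R : pzRingType) (I : choiceType) (M : I -> lmodType R).

Record dsum := DSum {
  dsum_val :> forall i, M i ;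
  dsum_fin : `[< finite_set [set i | dsum_val i != 0] >] }.

HB.instance Definition _ := gen_eqMixin dsum.
HB.instance Definition _ := gen_choiceMixin dsum.

Lemma dsumP (x y : dsum) : (forall i, x i = y i) -> x = y.
Proof.
case: x y => [x hx] [y hy] /= xy.
have {}xy : x = y by exact: functional_extensionality_dep.
by case: _ / xy hy => hy; congr DSum; exact: bool_irrelevance.
Qed.

Let fin_op (x y z : forall i, M i) :
  `[< finite_set [set i | x i != 0] >] -> `[< finite_set [set i | y i != 0] >] ->
  (forall i, x i = 0 -> y i = 0 -> z i = 0) ->
  `[< finite_set [set i | z i != 0] >].
Proof.
move=> /asboolP fx /asboolP fy xyz; apply/asboolP.
apply: (@sub_finite_set _ _ ([set i | x i != 0] `|` [set i | y i != 0])); last first.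
  by rewrite finite_setU.
move=> i /= zi; have [xi|xi] := eqVneq (x i) 0; last by left.
by right; apply: contra_neq zi; exact: xyz.
Qed.

Lemma dsum0_fin : `[< finite_set [set i | (0 : M i) != 0] >].
Proof.
apply/asboolP; rewrite (_ : [set i | _] = set0) //.
by apply/seteqP; split=> i //=; rewrite eqxx.
Qed.
Definition dsum0 : dsum := @DSum (fun i => 0) dsum0_fin.

Lemma dsum_add_fin (x y : dsum) : `[< finite_set [set i | x i + y i != 0] >].
Proof. by apply: fin_op (dsum_fin x) (dsum_fin y) _ => i -> ->; rewrite addr0. Qed.
Definition dsum_add x y := DSum (dsum_add_fin x y).

Lemma dsum_opp_fin (x : dsum) : `[< finite_set [set i | - x i != 0] >].
Proof. by apply: fin_op (dsum_fin x) (dsum_fin x) _ => i ->; rewrite oppr0. Qed.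
Definition dsum_opp x := DSum (dsum_opp_fin x).

Lemma dsum_scale_fin a (x : dsum) : `[< finite_set [set i | a *: x i != 0] >].
Proof. by apply: fin_op (dsum_fin x) (dsum_fin x) _ => i ->; rewrite scaler0. Qed.
Definition dsum_scale a x := DSum (dsum_scale_fin a x).

Lemma dsum_addA : associative dsum_add.
Proof. by move=> x y z; apply: dsumP => i /=; rewrite addrA. Qed.
Lemma dsum_addC : commutative dsum_add.
Proof. by move=> x y; apply: dsumP => i /=; rewrite addrC. Qed.
Lemma dsum_add0 : left_id dsum0 dsum_add.
Proof. by move=> x; apply: dsumP => i /=; rewrite add0r. Qed.
Lemma dsum_addN : left_inverse dsum0 dsum_opp dsum_add.
Proof. by move=> x; apply: dsumP => i /=; rewrite addNr. Qed.

HB.instance Definition _ :=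
  GRing.isZmodule.Build dsum dsum_addA dsum_addC dsum_add0 dsum_addN.

Lemma dsum_scaleA a b x : dsum_scale a (dsum_scale b x) = dsum_scale (a * b) x.
Proof. by apply: dsumP => i /=; rewrite scalerA. Qed.
Lemma dsum_scale1 : left_id 1 dsum_scale.
Proof. by move=> x; apply: dsumP => i /=; rewrite scale1r. Qed.
Lemma dsum_scaleDr : right_distributive dsum_scale +%R.
Proof. by move=> a x y; apply: dsumP => i /=; rewrite scalerDr. Qed.
Lemma dsum_scaleDl x : {morph dsum_scale^~ x : a b / a + b}.
Proof. by move=> a b; apply: dsumP => i /=; rewrite scalerDl. Qed.

HB.instance Definition _ := GRing.Zmodule_isLmodule.Build R dsum
  dsum_scaleA dsum_scale1 dsum_scaleDr dsum_scaleDl.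

Definition dsum_inj_val i (m : M i) : forall j, M j :=
  dfwith (fun j => 0 : M j) m.

Lemma dsum_inj_fin i (m : M i) :
  `[< finite_set [set j | dsum_inj_val m j != 0] >].
Proof.
apply/asboolP/(sub_finite_set _ (finite_set1 i)) => j /=.
by rewrite /dsum_inj_val; case: dfwithP => // k; rewrite eqxx.
Qed.

Definition dsum_inj i (m : M i) : dsum := DSum (dsum_inj_fin m).

Lemma dsum_inj_linear i : linear (@dsum_inj i).
Proof.
move=> a m m'; apply: dsumP => j /=; rewrite /dsum_inj_val.
have [ij|ij] := eqVneq i j; first by case: _ / ij; rewrite !dfwith_in.
by rewrite !dfwith_out // scaler0 addr0.
Qed.

HB.instance Definition _ i :=
  GRing.isLinear.Build R (M i) dsum _ (@dsum_inj i) (@dsum_inj_linear i).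

End DirectSum.

Section QuotRing.
Variables (T : pzRingType) (G : set T).

Definition ideal2 : set T :=
  [set v | exists2 s : seq (T * T * T),
     (forall p, p \in s -> G p.1.2) & v = \sum_(p <- s) p.1.1 * p.1.2 * p.2].

Lemma ideal2_gen a g b : G g -> ideal2 (a * g * b).
Proof.
move=> Gg; exists [:: (a, g, b)]; last by rewrite big_seq1.
by move=> p; rewrite mem_seq1 => /eqP -> /=.
Qed.

Lemma ideal2D u v : ideal2 u -> ideal2 v -> ideal2 (u + v).
Proof.
move=> [s sG ->] [t tG ->]; exists (s ++ t); last by rewrite big_cat.
by move=> p; rewrite mem_cat => /orP[/sG|/tG].
Qed.

Lemma ideal2M a v b : ideal2 v -> ideal2 (a * v * b).
Proof.
move=> [s sG ->]; exists [seq (a * p.1.1, p.1.2, p.2 * b) | p <- s].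
  by move=> _ /mapP[p ps ->]; exact: (sG _ ps).
rewrite big_map mulr_sumr mulr_suml.
by apply: eq_bigr => p _; rewrite !mulrA.
Qed.

Definition ideal2_pred : {pred T} := fun v => `[< ideal2 v >].

Lemma ideal2_zmod_closed : zmod_closed ideal2_pred.
Proof.
split; first by apply/asboolP; exists [::] => //; rewrite big_nil.
move=> u v /asboolP su /asboolP sv; apply/asboolP/ideal2D => //.
by rewrite -mulN1r -[X in ideal2 X]mulr1; exact: ideal2M.
Qed.

HB.instance Definition _ :=
  GRing.isZmodClosed.Build T ideal2_pred ideal2_zmod_closed.

Definition quot_ring := Quotient.quot ideal2_pred.

HB.instance Definition _ := GRing.Zmodule.on quot_ring.
HB.instance Definition _ := EqQuotient.on quot_ring.

Definition qring_class (v : T) : quot_ring := \pi v.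

Lemma qring_classE u v : (qring_class u = qring_class v) <-> ideal2 (u - v).
Proof.
rewrite /qring_class; split.
  by move=> /eqP; rewrite -Quotient.idealrBE => /asboolP.
by move=> /asboolP h; apply/eqP; rewrite -Quotient.idealrBE.
Qed.

Lemma qring_classB : zmod_morphism qring_class.
Proof. by move=> u v; rewrite /qring_class raddfB. Qed.

HB.instance Definition _ :=
  GRing.isZmodMorphism.Build T quot_ring qring_class qring_classB.

Lemma qring_class_surj (q : quot_ring) : qring_class (repr q) = q.
Proof. exact: reprK. Qed.

Definition qring_one : quot_ring := qring_class 1.
Definition qring_mul (p q : quot_ring) : quot_ring :=
  qring_class (repr p * repr q).

Lemma qring_mulE u v :
  qring_mul (qring_class u) (qring_class v) = qring_class (u * v).
Proof.
apply/qring_classE; set u' := repr _; set v' := repr _.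
have hu : ideal2 (u' - u) by apply/qring_classE; rewrite qring_class_surj.
have hv : ideal2 (v' - v) by apply/qring_classE; rewrite qring_class_surj.
rewrite -[u' * v'](addrNK (u' * v)) -mulrBr -addrA -mulrBl; apply: ideal2D.
  by rewrite -[X in ideal2 X]mulr1; exact: ideal2M.
by rewrite -[u' - u]mul1r; exact: ideal2M.
Qed.

Lemma qring_mulA : associative qring_mul.
Proof.
move=> x y z; rewrite -(qring_class_surj x) -(qring_class_surj y).
by rewrite -(qring_class_surj z) !qring_mulE mulrA.
Qed.
Lemma qring_mul1l : left_id qring_one qring_mul.
Proof. by move=> x; rewrite -(qring_class_surj x) qring_mulE mul1r. Qed.
Lemma qring_mul1r : right_id qring_one qring_mul.
Proof. by move=> x; rewrite -(qring_class_surj x) qring_mulE mulr1. Qed.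
Lemma qring_mulDl : left_distributive qring_mul +%R.
Proof.
move=> x y z; rewrite -(qring_class_surj x) -(qring_class_surj y).
by rewrite -(qring_class_surj z) -raddfD !qring_mulE mulrDl raddfD.
Qed.
Lemma qring_mulDr : right_distributive qring_mul +%R.
Proof.
move=> x y z; rewrite -(qring_class_surj x) -(qring_class_surj y).
by rewrite -(qring_class_surj z) -raddfD !qring_mulE mulrDr raddfD.
Qed.

HB.instance Definition _ := GRing.Zmodule_isPzRing.Build quot_ring
  qring_mulA qring_mul1l qring_mul1r qring_mulDl qring_mulDr.

Lemma qring_class_monoid : monoid_morphism qring_class.
Proof. by split=> // u v; rewrite -qring_mulE. Qed.

HB.instance Definition _ :=
  GRing.isMonoidMorphism.Build T quot_ring qring_class qring_class_monoid.

End QuotRing.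

Section DiffOp.
Variables (n : nat) (K : comNzRingType).
Implicit Types p q r : {mpoly K[n]}.

(* The variable 'X_j of the operator [p] acts as the derivation d/dy_j. *)
Definition diffop p q : {mpoly K[n]} :=
  \sum_(m <- msupp p) p@_m *: mderivm m q.

Lemma diffopwE k p q : (msize p <= k)%N ->
  diffop p q = \sum_(m : 'X_{1..n < k}) p@_m *: mderivm m q.
Proof.
move=> pk; rewrite /diffop (big_mksub 'X_{1..n < k}) /=; first last.
- by move=> m /msize_mdeg_lt/leq_trans/(_ pk).
- exact: msupp_uniq.
by rewrite big_rmcond //= => m /memN_msupp_eq0 ->; rewrite scale0r.
Qed.

Lemma diffopDl q : {morph diffop^~ q : p p' / p + p'}.
Proof.
move=> p p' /=; pose k := maxn (msize (p + p')) (maxn (msize p) (msize p')).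
rewrite !(@diffopwE k) ?leq_max ?leqnn ?orbT // -big_split /=.
by apply: eq_bigr => m _; rewrite mcoeffD scalerDl.
Qed.

Lemma diffopZl a p q : diffop (a *: p) q = a *: diffop p q.
Proof.
pose k := maxn (msize (a *: p)) (msize p).
rewrite !(@diffopwE k) ?leq_max ?leqnn ?orbT // scaler_sumr.
by apply: eq_bigr => m _; rewrite mcoeffZ scalerA.
Qed.

Lemma diffopX m q : diffop 'X_[m] q = mderivm m q.
Proof. by rewrite /diffop msuppX big_seq1 mcoeffX eqxx scale1r. Qed.

Lemma diffop0l q : diffop 0 q = 0.
Proof. by rewrite /diffop msupp0 big_nil. Qed.

Lemma diffopDr p : {morph diffop p : q q' / q + q'}.
Proof.
by move=> q q'; rewrite -big_split; apply: eq_bigr => m _; rewrite linearD scalerDr.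
Qed.

Lemma diffopZr p a q : diffop p (a *: q) = a *: diffop p q.
Proof.
rewrite scaler_sumr; apply: eq_bigr => m _.
by rewrite linearZ /= !scalerA mulrC.
Qed.

Lemma diffop_comp p p' q : diffop p (diffop p' q) = diffop (p * p') q.
Proof.
elim/mpolyind: p => [|a m p _ _ IH]; first by rewrite mul0r !diffop0l.
rewrite mulrDl !diffopDl IH; congr (_ + _).
rewrite -scalerAl !diffopZl diffopX; congr (_ *: _).
elim/mpolyind: p' {p IH} => [|b m' p' _ _ IH].
  by rewrite mulr0 !diffop0l linear0.
rewrite mulrDr !diffopDl linearD /= IH; congr (_ + _).
rewrite -scalerAr !diffopZl linearZ /= diffopX -mpolyXD diffopX.
by rewrite addmC mderivmDm.
Qed.

Lemma diffop1 : left_id 1 diffop.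
Proof. by move=> q; rewrite -mpolyX0 diffopX mderivm0m. Qed.

Definition dpoly : Type := {mpoly K[n]}.

HB.instance Definition _ := GRing.Zmodule.on dpoly.

HB.instance Definition _ := GRing.Zmodule_isLmodule.Build {mpoly K[n]} dpoly
  diffop_comp diffop1 diffopDr diffopDl.

End DiffOp.

Section Hom.
Variables (n : nat) (K : comNzRingType) (M : lmodType {mpoly K[n]}).

Definition homS := {linear M -> dpoly n K}.

HB.instance Definition _ := gen_eqMixin homS.
HB.instance Definition _ := gen_choiceMixin homS.

Lemma homSP (f g : homS) : f =1 g -> f = g.
Proof.
case: f g => [f [[hf] [hf']]] [g [[hg] [hg']]] /= fg.
have {}fg : f = g by exact: funext.
by subst g; rewrite (Prop_irrelevance hf hg) (Prop_irrelevance hf' hg').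
Qed.

Definition homS0 : homS := \0.
Definition homS_add (f g : homS) : homS := f \+ g.
Definition homS_opp (f : homS) : homS := \- f.

Definition homS_scale_fun (a : K) (f : homS) (x : M) : dpoly n K :=
  a *: (f x : {mpoly K[n]}).

Lemma homS_scale_linear a f : linear (homS_scale_fun a f).
Proof.
move=> p x y; rewrite /homS_scale_fun linearP.
have -> : p *: f x + f y = diffop p (f x) + f y by [].
by rewrite [LHS](@scalerDr K {mpoly K[n]}) -diffopZr.
Qed.

HB.instance Definition _ a f := GRing.isLinear.Build {mpoly K[n]} M (dpoly n K) _
  (homS_scale_fun a f) (homS_scale_linear a f).

Definition homS_scale a f : homS := homS_scale_fun a f.

Lemma homS_addA : associative homS_add.
Proof. by move=> f g h; apply: homSP => x /=; rewrite addrA. Qed.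
Lemma homS_addC : commutative homS_add.
Proof. by move=> f g; apply: homSP => x /=; rewrite addrC. Qed.
Lemma homS_add0 : left_id homS0 homS_add.
Proof. by move=> f; apply: homSP => x /=; rewrite add0r. Qed.
Lemma homS_addN : left_inverse homS0 homS_opp homS_add.
Proof. by move=> f; apply: homSP => x /=; rewrite addNr. Qed.

HB.instance Definition _ :=
  GRing.isZmodule.Build homS homS_addA homS_addC homS_add0 homS_addN.

Lemma homS_scaleA a b f : homS_scale a (homS_scale b f) = homS_scale (a * b) f.
Proof. by apply: homSP => x; exact: (@scalerA K {mpoly K[n]}). Qed.
Lemma homS_scale1 : left_id 1 homS_scale.
Proof. by move=> f; apply: homSP => x; exact: (@scale1r K {mpoly K[n]}). Qed.
Lemma homS_scaleDr : right_distributive homS_scale +%R.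
Proof. by move=> a f g; apply: homSP => x; exact: (@scalerDr K {mpoly K[n]}). Qed.
Lemma homS_scaleDl f : {morph homS_scale^~ f : a b / a + b}.
Proof. by move=> a b; apply: homSP => x; exact: (@scalerDl K {mpoly K[n]}). Qed.

HB.instance Definition _ := GRing.Zmodule_isLmodule.Build K homS
  homS_scaleA homS_scale1 homS_scaleDr homS_scaleDl.

End Hom.

Section HomRestr.
Variables (n : nat) (K : comNzRingType) (I : choiceType).
Variable M : I -> lmodType {mpoly K[n]}.

Definition homS_restr (i : I) (Psi : homS (dsum M)) : homS (M i) :=
  Psi \o @dsum_inj _ _ M i.

End HomRestr.

(* The series [\sum_gamma x^gamma p_gamma(log x)] is the family [gamma |-> p_gamma];
   exponents range over all of K^n and the restriction to a class modulo Z^n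
   is a condition on the support. *)
Definition series (n : nat) (K : fieldType) := 'cV[K]_n -> {mpoly K[n]}.

HB.instance Definition _ n K := GRing.Lmodule.on (series n K).

Definition Supp n K (phi : series n K) : set 'cV[K]_n :=
  [set gamma | phi gamma != 0].

Section Weyl.
Variables (n : nat) (K : fieldType).

(* The free algebra on x_1, ..., x_n (letters [inl j]) and
   d_1, ..., d_n (letters [inr j]). *)
Definition weyl_letter : Type := ('I_n + 'I_n)%type.
HB.instance Definition _ := Choice.on weyl_letter.
Definition weyl_free := {malg K[{fmonom weyl_letter}]}.
HB.instance Definition _ := GRing.NzRing.on weyl_free.
HB.instance Definition _ := GRing.Lmodule.on weyl_free.

Definition free_x j : weyl_free := mkmalgU (fmu (inl j)) 1.
Definition free_d j : weyl_free := mkmalgU (fmu (inr j)) 1.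

Definition weyl_rel : set weyl_free :=
  [set g | exists i j,
    [\/ g = free_x i * free_x j - free_x j * free_x i,
        g = free_d i * free_d j - free_d j * free_d i |
        g = free_d i * free_x j - free_x j * free_d i - (i == j)%:R]].

Definition weyl : Type := quot_ring weyl_rel.
HB.instance Definition _ := GRing.PzRing.on weyl.

Definition weyl_class : {rmorphism weyl_free -> weyl} := qring_class weyl_rel.

Definition weyl_C (c : K) : weyl := weyl_class (mkmalgU mone c).
Definition weyl_x j : weyl := weyl_class (free_x j).
Definition weyl_d j : weyl := weyl_class (free_d j).

Definition letter_act (a : weyl_letter) (phi : series n K) : series n K :=
  fun gamma => match a with
  | inl j => phi (gamma - delta_mx j 0)
  | inr j => let gamma' := gamma + delta_mx j 0 in
             gamma' j 0 *: phi gamma' + mderiv j (phi gamma')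
  end.

Definition word_act (m : {fmonom weyl_letter}) (phi : series n K) : series n K :=
  foldr letter_act phi m.

Definition free_act (P : weyl_free) (phi : series n K) : series n K :=
  \sum_(m <- monalg.msupp P) monalg.mcoeff m P *: word_act m phi.

Definition weyl_act (P : weyl) (phi : series n K) : series n K :=
  free_act (repr P) phi.

Lemma letter_act_linear a : linear (letter_act a).
Proof.
move=> c f g; apply/funext => gamma; case: a => j //=.
set gamma' := gamma + _; set z := gamma' j 0.
transitivity (z *: (c *: f gamma' + g gamma') + mderiv j (c *: f gamma' + g gamma')) => //.
transitivity (c *: (z *: f gamma' + mderiv j (f gamma')) +
              (z *: g gamma' + mderiv j (g gamma'))) => //.
by rewrite mderivD mderivZ !scalerDr !scalerA [c * z]mulrC addrACA.
Qed.
HB.instance Definition _ a := GRing.isLinear.Build K (series n K) (series n K) _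
  (letter_act a) (letter_act_linear a).

Lemma word_act_linear m : linear (word_act m).
Proof.
move=> c f g; rewrite /word_act; elim: (fmonom_val m) => //= a s ->.
by rewrite linearP.
Qed.
HB.instance Definition _ m := GRing.isLinear.Build K (series n K) (series n K) _
  (word_act m) (word_act_linear m).

Lemma free_actEw (d : {fset {fmonom weyl_letter}}) P phi :
  (monalg.msupp P `<=` d)%fset ->
  free_act P phi = \sum_(m <- d) monalg.mcoeff m P *: word_act m phi.
Proof.
move=> le; rewrite [LHS](big_fset_incl _ le) => //= x xd /mcoeff_outdom ->.
by rewrite scale0r.
Qed.

Lemma free_actZl c P phi : free_act (c *: P) phi = c *: free_act P phi.
Proof.
rewrite (free_actEw _ (monalg.msuppZ_le _ _)) scaler_sumr.
by apply: eq_bigr => m _; rewrite monalg.mcoeffZ scalerA.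
Qed.

Lemma free_actDl phi : {morph free_act^~ phi : P Q / P + Q}.
Proof.
move=> P Q /=; set d := (monalg.msupp P `|` monalg.msupp Q)%fset.
rewrite !(@free_actEw d) ?fsubsetUl ?fsubsetUr ?(monalg.msuppD_le _ _) //.
by rewrite -big_split; apply: eq_bigr => m _; rewrite monalg.mcoeffD scalerDl.
Qed.

Lemma free_act0l phi : free_act 0 phi = 0.
Proof. by rewrite /free_act monalg.msupp0 big_seq_fset0. Qed.

Lemma free_actNl P phi : free_act (- P) phi = - free_act P phi.
Proof. by rewrite -scaleN1r free_actZl scaleN1r. Qed.

Lemma free_actU m c phi : free_act (mkmalgU m c) phi = c *: word_act m phi.
Proof. by rewrite (free_actEw _ monalg.msuppU_le) big_seq_fset1 monalg.mcoeffUU. Qed.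

Lemma free_act_linear P : linear (free_act P).
Proof.
move=> c f g; rewrite scaler_sumr -big_split; apply: eq_bigr => m _.
by rewrite linearP /= scalerDr !scalerA mulrC.
Qed.
HB.instance Definition _ P := GRing.isLinear.Build K (series n K) (series n K) _
  (free_act P) (free_act_linear P).

Lemma free_actM P Q phi : free_act (P * Q) phi = free_act P (free_act Q phi).
Proof.
have suml (I : Type) (r : seq I) (F : I -> weyl_free) psi :
    free_act (\sum_(i <- r) F i) psi = \sum_(i <- r) free_act (F i) psi.
  by apply: (big_morph (free_act^~ psi)); [exact: free_actDl|exact: free_act0l].
rewrite malgME suml; apply: eq_bigr => m _.
rewrite suml linear_sum scaler_sumr; apply: eq_bigr => m' _.
rewrite free_actU linearZ /= scalerA; congr (_ *: _).
by rewrite /word_act fmM foldr_cat.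
Qed.

Lemma free_act1 phi : free_act 1 phi = phi.
Proof. by rewrite free_actU scale1r /word_act fm1. Qed.

Lemma free_actx j phi : free_act (free_x j) phi = letter_act (inl j) phi.
Proof. by rewrite free_actU scale1r /word_act fmU. Qed.

Lemma free_actd j phi : free_act (free_d j) phi = letter_act (inr j) phi.
Proof. by rewrite free_actU scale1r /word_act fmU. Qed.

Lemma free_act_rel g phi : weyl_rel g -> free_act g phi = 0.
Proof.
have letter_actE j psi gamma (gamma' := gamma + delta_mx j 0) :
    letter_act (inr j) psi gamma =
    gamma' j 0 *: psi gamma' + mderiv j (psi gamma') by [].
have free_act_nat (k : nat) psi : free_act k%:R psi = k%:R *: psi.
  elim: k => [|k IH]; first by rewrite free_act0l scale0r.
  by rewrite -addn1 !natrD free_actDl IH free_act1 scalerDl scale1r.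
have comm (P Q : weyl_free) psi : free_act (P * Q - Q * P) psi =
    free_act P (free_act Q psi) - free_act Q (free_act P psi).
  
  rewrite (free_actDl psi (P * Q)).
  rewrite (free_actNl (Q * P)).
  by congr (_ - _); exact: free_actM.

have commN (P Q : weyl_free) (k : nat) psi :
    free_act (P * Q - Q * P - k%:R) psi =
    free_act P (free_act Q psi) - free_act Q (free_act P psi) - k%:R *: psi.
  rewrite (free_actDl psi (P * Q - Q * P)) (free_actNl k%:R).
  by congr (_ - _); [exact: comm|exact: free_act_nat].
move=> [i [j]] [] ->.
- apply/eqP; rewrite comm !free_actx subr_eq0; apply/eqP/funext => gamma.
  by rewrite /= addrAC.
- apply/eqP; rewrite comm !free_actd subr_eq0; apply/eqP.
  have [->//|ij] := eqVneq i j; apply/funext => gamma.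
  rewrite !letter_actE [gamma + _ + delta_mx i 0]addrAC.
  rewrite !mderivD !mderivZ !scalerDr [in RHS]mderiv_comm addrACA.
  rewrite !scalerA.
  have ji : j != i by rewrite eq_sym.
  by rewrite !mxE !eqxx (negbTE ij) (negbTE ji) /= !addr0 [in LHS]mulrC.
- apply/eqP; rewrite commN !free_actd !free_actx subr_eq0 subr_eq; apply/eqP/funext => gamma.
  transitivity (letter_act (inr i) (letter_act (inl j) phi) gamma) => //.
  transitivity ((i == j)%:R *: phi gamma +
    letter_act (inl j) (letter_act (inr i) phi) gamma) => //.
  rewrite [LHS]/= [letter_act (inl j) _ _]/= [gamma - _ + _]addrAC addrA.
  congr (_ + _); rewrite !mxE !eqxx; have [->|ij] := eqVneq i j.
    by rewrite addrK -scalerDl /= addrK addrC.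
  by rewrite /= scale0r add0r subr0.
Qed.

Lemma free_act_ideal P phi : ideal2 weyl_rel P -> free_act P phi = 0.
Proof.
move=> [s sG ->]; elim: s sG => [|p s IH] sG.
  by rewrite big_nil free_act0l.
rewrite big_cons free_actDl IH ?addr0; last first.
  by move=> q qs; apply: sG; rewrite inE qs orbT.
rewrite (free_actM _ p.2) (free_actM p.1.1).
by rewrite (free_act_rel _ (sG _ (mem_head _ _))) linear0.
Qed.

Lemma weyl_actE P phi : weyl_act (weyl_class P) phi = free_act P phi.
Proof.
apply/eqP; rewrite -subr_eq0 -free_actNl -free_actDl; apply/eqP.
by apply: free_act_ideal; apply/qring_classE; rewrite qring_class_surj.
Qed.

Lemma weyl_actx j phi gamma :
  weyl_act (weyl_x j) phi gamma = phi (gamma - delta_mx j 0).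
Proof. by rewrite weyl_actE free_actx. Qed.

Lemma weyl_actd j phi gamma (gamma' := gamma + delta_mx j 0) :
  weyl_act (weyl_d j) phi gamma =
  gamma' j 0 *: phi gamma' + mderiv j (phi gamma').
Proof. by rewrite weyl_actE free_actd. Qed.

Lemma weyl_actC c phi : weyl_act (weyl_C c) phi = c *: phi.
Proof. by rewrite weyl_actE free_actU /word_act fm1. Qed.

Lemma weyl_actDl phi : {morph weyl_act^~ phi : P Q / P + Q}.
Proof.
move=> P Q; rewrite -(qring_class_surj P) -(qring_class_surj Q) -raddfD.
by rewrite !weyl_actE free_actDl.
Qed.

Lemma weyl_actM P Q phi : weyl_act (P * Q) phi = weyl_act P (weyl_act Q phi).
Proof.
rewrite -(qring_class_surj P) -(qring_class_surj Q) -rmorphM.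
by rewrite !weyl_actE free_actM.
Qed.

Lemma weyl_act_linear P : linear (weyl_act P).
Proof. exact: free_act_linear. Qed.

End Weyl.

Section Hypergeometric.
Variables (R : realType) (d n : nat) (A : 'M[int]_(d, n)).
Local Notation C := R[i].
Local Notation S := {mpoly C[n]}.

Definition kerZ : set 'cV[int]_n := [set u | A *m u = 0].

Definition toC (u : 'cV[int]_n) : 'cV[C]_n := map_mx intr u.

Definition Lgeneric (w : 'cV[R]_n) : Prop :=
  forall u, kerZ u -> u != 0 -> \sum_j w j 0 * (u j 0)%:~R != 0.

Definition is_exp_lattice (beta : 'cV[C]_d) (Lam : set 'cV[C]_n) : Prop :=
  exists2 lam, map_mx intr A *m lam = beta & Lam = [set lam + toC u | u in kerZ].

Definition exp_lattice (beta : 'cV[C]_d) : Type :=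
  {Lam : set 'cV[C]_n | `[< is_exp_lattice beta Lam >]}.

Definition expset beta (Lam : exp_lattice beta) : set 'cV[C]_n := val Lam.
Coercion expset : exp_lattice >-> set.

Definition pos_part (u : 'cV[int]_n) : 'X_{1..n} :=
  [multinom absz (Num.max (u j 0) 0)%R | j < n].

Definition toric_ideal : set S :=
  span (V := S^o) [set 'X_[pos_part u] - 'X_[pos_part (- u)] | u in kerZ].

Definition weyl_of_poly (p : S) : weyl n C :=
  \sum_(m <- msupp p) weyl_C n p@_m * \prod_j weyl_d C j ^+ m j.

Definition euler_op (beta : 'cV[C]_d) (i : 'I_d) : weyl n C :=
  (\sum_j (weyl_x C j * weyl_d C j) *~ A i j) - weyl_C n (beta i 0).

(* In [V^o] the submodules are the left ideals. *)
Definition hyp_ideal (beta : 'cV[C]_d) : set (weyl n C) :=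
  span (V := (weyl n C)^o)
    ([set weyl_of_poly p | p in toric_ideal] `|` range (euler_op beta)).

Definition nsupp (gamma : 'cV[C]_n) : {set 'I_n} :=
  finset (fun j => `[< exists m : nat, gamma j 0 = - m.+1%:R >]).

Definition stratum (Lam : set 'cV[C]_n) (I : {set 'I_n}) : set 'cV[C]_n :=
  [set gamma | Lam gamma /\ nsupp gamma = I].

Definition NS (Lam : set 'cV[C]_n) : set {set 'I_n} :=
  [set I | stratum Lam I !=set0].

Definition MinNS (Lam : set 'cV[C]_n) : set {set 'I_n} :=
  [set I | NS Lam I /\ forall J, NS Lam J -> J \subset I -> J = I].

Definition wdot (w : 'cV[R]_n) (v : 'cV[C]_n) : C :=
  \sum_j (w j 0)%:C%C * v j 0.

(* On [R[i]], [0 <= z] means that z is a nonnegative real number. *)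
Definition le_dir (w : 'cV[R]_n) (gamma gamma' : 'cV[C]_n) : Prop :=
  0 <= wdot w (gamma' - gamma).

Definition bounded_dir (w : 'cV[R]_n) (Lam : set 'cV[C]_n) : set {set 'I_n} :=
  [set I | NS Lam I /\ exists2 lam, Lam lam &
     exists b : R, forall gamma, stratum Lam I gamma ->
       b%:C%C <= wdot w (gamma - lam)].

Definition min_dir (w : 'cV[R]_n) (Lam : set 'cV[C]_n) : set {set 'I_n} :=
  MinNS Lam `&` bounded_dir w Lam.

Definition adm_dir (w : 'cV[R]_n) (Lam : set 'cV[C]_n) : set {set 'I_n} :=
  [set I | NS Lam I /\
     forall J, NS Lam J -> J \subset I -> bounded_dir w Lam J].

Definition adm_lattice beta (w : 'cV[R]_n) : set (exp_lattice beta) :=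
  [set Lam | min_dir w Lam !=set0].

Definition extended_class (Lam : set 'cV[C]_n) : set 'cV[C]_n :=
  [set gamma | exists2 lam, Lam lam & exists u, gamma = lam + toC u].

Definition sol_dir beta (w : 'cV[R]_n) (Lam : set 'cV[C]_n) : set (series n C) :=
  [set phi | [/\ Supp phi `<=` extended_class Lam, Supp phi `<=` Lam,
     forall P, hyp_ideal beta P -> weyl_act P phi = 0 &
     phi = 0 \/ exists2 gamma0, Supp phi gamma0 &
       forall gamma, Supp phi gamma -> le_dir w gamma0 gamma]].

(* The direct sum of the [sol_dir]: its elements are families, since the sums
   of the components live in different spaces of series. *)
Definition sol_dir_all beta (w : 'cV[R]_n) : set (exp_lattice beta -> series n C) :=
  [set Phi | (forall Lam : exp_lattice beta, sol_dir beta w Lam (Phi Lam)) /\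
             finite_set [set Lam | Phi Lam != 0]].

Definition dmon (K : {set 'I_n}) : S := \prod_(j in K) 'X_j.

Definition falling (alpha : 'cV[C]_n) (nu : 'X_{1..n}) : S :=
  \prod_j \prod_(k < nu j) ('X_j + (alpha j 0 - k%:R)%:MP).

(* The positive part of an integer z, given as a complex number. *)
Definition natpart (z : C) : nat := xget 0%N [set m : nat | z = m%:R].

(* [transit gamma' gamma] is d_{gamma' <- gamma}. *)
Definition transit (gamma' gamma : 'cV[C]_n) : S :=
  falling gamma [multinom natpart ((gamma - gamma') j 0)%R | j < n].

(* [transit gamma' gamma] is divisible by this monomial when gamma - gamma' is an
   integer vector, and the quotient is unique since [S] is an integral domain. *)
Definition ntransit (gamma' gamma : 'cV[C]_n) : S :=
  xget 0 [set q | transit gamma' gamma = q * dmon (nsupp gamma' :\: nsupp gamma)].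

(* [ntransit gamma' gamma] acts bijectively, so that [op_inv] then selects the
   only preimage. *)
Definition op_inv (q : S) (p : dpoly n C) : dpoly n C :=
  xget 0 [set r | q *: r = p].

Definition NS_type (Lam : set 'cV[C]_n) : Type :=
  {I : {set 'I_n} | `[< NS Lam I >]}.

Definition Afree (Lam : set 'cV[C]_n) : lmodType S := {ffun NS_type Lam -> S^o}.

(* The basis vector of index I; it is 0 if I is not in [NS Lam]. *)
Definition estar (Lam : set 'cV[C]_n) (I : {set 'I_n}) : Afree Lam :=
  [ffun J : NS_type Lam => (val J == I)%:R].

Definition Ady (i : 'I_d) : S := \sum_j 'X_j *~ A i j.

Definition Mdir_rel (w : 'cV[R]_n) (Lam : set 'cV[C]_n) : set (Afree Lam) :=
  [set v | [\/ exists i I, NS Lam I /\ v = Ady i *: estar Lam I,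
     exists I J, [/\ NS Lam I, NS Lam J &
       v = dmon (J :\: I) *: estar Lam I - dmon (I :\: J) *: estar Lam J] |
     exists K, [/\ NS Lam K, ~ adm_dir w Lam K & v = estar Lam K]]].

Definition Mdir (w : 'cV[R]_n) (Lam : set 'cV[C]_n) : lmodType S :=
  quot_mod (@Mdir_rel w Lam).

Definition ebar (w : 'cV[R]_n) (Lam : set 'cV[C]_n) (I : {set 'I_n}) : Mdir w Lam :=
  quot_class (@Mdir_rel w Lam) (estar Lam I).

Definition Mdir_all beta (w : 'cV[R]_n) : lmodType S :=
  dsum (fun Lam : exp_lattice beta => Mdir w Lam).

Definition Ser (w : 'cV[R]_n) (Lam : set 'cV[C]_n) (lam : 'cV[C]_n)
    (psi : homS (Mdir w Lam)) : series n C :=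
  fun gamma =>
    if `[< Lam gamma >] then
      op_inv (ntransit lam gamma)
             (ntransit gamma lam *: psi (ebar w Lam (nsupp gamma)))
    else 0.

Definition restr beta (w : 'cV[R]_n) (Lam : exp_lattice beta)
    (Psi : homS (Mdir_all beta w)) : homS (Mdir w Lam) :=
  homS_restr Lam Psi.

(* A homomorphism on the direct sum is identified with the family of its
   restrictions to the admissible summands, the other summands being zero. *)
Definition Ser_all beta (w : 'cV[R]_n) (lam : exp_lattice beta -> 'cV[C]_n)
    (Psi : homS (Mdir_all beta w)) : exp_lattice beta -> series n C :=
  fun Lam => if `[< adm_lattice w Lam >] then Ser (lam Lam) (restr Lam Psi) else 0.

End Hypergeometric.

Arguments sol_dir_all {R d n} A beta w.

Definition linear_iso_onto (K : pzRingType) (U V : lmodType K) (f : U -> V)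
    (W : set V) : Prop := linear f /\ set_bij [set: U] W f.

(* Main.v *)
From HB Require Import structures.
Require Import Defs.
From mathcomp Require Import all_boot all_order all_algebra.
From mathcomp Require Import boolp classical_sets functions cardinality.
From mathcomp Require Import reals complex ssrcomplements mpoly zify ring.

Set Implicit Arguments.
Unset Strict Implicit.
Unset Printing Implicit Defensive.

Import Order.TTheory GRing.Theory Num.Theory.

Local Open Scope classical_set_scope.
Local Open Scope ring_scope.

(** The idea.  Applied coefficientwise, the hypergeometric ideal annihilates a
    series supported in a lattice [Lam] exactly when its coefficients p_gamma are
    killed by A d/dy and satisfy the transit equations
    d_(gamma' <- gamma) p_gamma = d_(gamma <- gamma') p_gamma'
    ([hyp_ideal_lattice]).  Formally d_(gamma' <- gamma) / d_(gamma <- gamma') is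
    the quotient of Gamma(d/dy + gamma + 1) by Gamma(d/dy + gamma' + 1), so these
    ratios form a cocycle, and so do the ratios of the monomials d/dy^nsupp, which
    carry the non-invertible part.  Dividing, the normalised transit operators have
    a nonzero constant term, hence act bijectively on polynomials ([diffop_bij]),
    and their ratios still form a cocycle ([ntransit_cocycle]).  Rescaling each p_gamma by the normalised ratio to one
    reference exponent therefore trivialises the invertible part of the system:
    what is left says that the rescaled coefficient c depends on nsupp(gamma) only
    and that d/dy^(J - I) c_I = d/dy^(I - J) c_J ([normalized_compatible]).  These
    are the defining relations of the module, so families [c] are homomorphisms
    ([family_of_hom], [hom_of_family]).

    The direction accounts for the remaining generators of the relations.  If the
    support has a minimum and c_K is nonzero, then c_J is nonzero for each J
    contained in K, because d/dy^(K - J) maps c_J to c_K; so the whole stratum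
    of J lies in the support and is bounded below, and K is admissible.  Conversely
    the support is a finite union of strata that are bounded below, and on each of
    them the weight attains its minimum: a stratum is the set of lattice points in a
    polyhedron, a vector of L pointing in its recession cone has nonnegative weight
    by boundedness, and Dickson's lemma concludes ([stratum_has_minimum]).

    Finally, if a lattice has a bounded stratum, then a vector of L that vanishes at
    its integral coordinates has weight zero, so is zero as the direction is generic.
    Hence an exponent is determined up to finitely many classes modulo L by the set
    of its integral coordinates ([kernel_bounded_denominator]), and the admissible
    lattices are finite in number ([finite_adm_lattice]).  On the other lattices
    the only directed solution and the only homomorphism are zero, which reduces
    the global statement to the admissible lattices one by one. *)

(** * Constant coefficient operators on polynomials *)

Section ConstantCoefficientOperators.
Variables (n : nat) (F : fieldType).
Local Notation S := {mpoly F[n]}.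
Implicit Types p q s : S.

Lemma msize_leP p k :
  (forall m, (k <= mdeg m)%N -> p@_m = 0) -> (msize p <= k)%N.
Proof.
move=> h; rewrite msizeE; apply/bigmax_leqP_seq => m mp _.
by rewrite ltnNge; apply: contraL mp => /h; rewrite -mcoeff_eq0 => ->.
Qed.

Lemma mcoeff_msize0 p k m : (msize p <= k)%N -> (k <= mdeg m)%N -> p@_m = 0.
Proof.
move=> pk km; apply/eqP; rewrite mcoeff_eq0.
by apply: msize_mdeg_ge; exact: leq_trans km.
Qed.

Lemma diffop_sum (I : Type) (r : seq I) (P : pred I) (G : I -> S) q :
  diffop (\sum_(i <- r | P i) G i) q = \sum_(i <- r | P i) diffop (G i) q.
Proof.
by apply: (big_morph (fun p => diffop p q)) => [p p'|]; rewrite ?diffopDl ?diffop0l.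
Qed.

Lemma diffop0r q : diffop q 0 = 0 :> S.
Proof. by rewrite -[0 in LHS](scale0r 0) diffopZr scale0r. Qed.

Lemma diffopBr q p p' : diffop q (p - p') = diffop q p - diffop q p'.
Proof. by rewrite diffopDr -scaleN1r diffopZr scaleN1r. Qed.

Lemma diffopC c p : diffop c%:MP p = c *: p.
Proof.
by rewrite -[c%:MP]mulr1 mul_mpolyC diffopZl diffop1.
Qed.

(** Every monomial of [s] has positive degree and so lowers the degree of [p]:
    this nilpotency replaces the geometric series in the inversion of
    operators. *)
Lemma msize_diffop s p k : s@_0%MM = 0 -> (msize p <= k.+1)%N ->
  (msize (diffop s p) <= k)%N.
Proof.
move=> s0 pk; apply: msize_leP => m km; rewrite raddf_sum /=.
rewrite big_seq big1 // => m' m's; rewrite mcoeffZ mcoeff_mderivm.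
rewrite (mcoeff_msize0 pk) ?mul0rn ?mulr0 // mdegD -add1n.
rewrite leq_add // lt0n mdeg_eq0; apply: contraTneq m's => ->.
by rewrite -mcoeff_eq0 s0.
Qed.

(** Writing [q] as a nonzero constant plus a locally nilpotent operator [s], a
    solution of q p = 0 equals the image under [s] of a multiple of itself, so its
    degree is as small as one likes; the same induction on the degree
    solves q r = p. *)
Lemma diffop_bij q : q@_0%MM != 0 -> bijective (@diffop n F q).
Proof.
move=> q0; pose c := q@_0%MM; pose s := q - c%:MP.
have s0 : s@_0%MM = 0 by rewrite mcoeffB mcoeffC eqxx mulr1 subrr.
have qE p : diffop q p = c *: p + diffop s p.
  by rewrite -diffopC -diffopDl addrC subrK.
have inj p : diffop q p = 0 -> p = 0.
  move=> qp0; suff h k : (msize p <= k)%N -> p = 0 by exact: (h _ (leqnn _)).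
  elim: k => [|k IH]; first by rewrite leqn0 msize_poly_eq0 => /eqP.
  move=> pk; apply: IH; have -> : p = diffop s (- c^-1 *: p).
    move: qp0; rewrite qE diffopZr => /eqP; rewrite addrC addr_eq0 => /eqP ->.
    by rewrite scalerN scaleNr opprK scalerA mulVf // scale1r.
  by apply: msize_diffop => //; exact: leq_trans (msizeZ_le _ _) pk.
have surj p : exists r, diffop q r = p.
  suff h k : forall p', (msize p' <= k)%N -> exists r, diffop q r = p'.
    exact: (h _ _ (leqnn _)).
  elim: k => [|k IH] p'.
    rewrite leqn0 msize_poly_eq0 => /eqP ->; exists 0; exact: diffop0r.
  move=> pk; pose t := c^-1 *: p'.
  have [r rE] := IH (diffop s t) (msize_diffop s0 (leq_trans (msizeZ_le _ _) pk)).
  exists (t - r).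
  by rewrite diffopBr rE qE addrK scalerA mulfV // scale1r.
have [g gP] := choice surj.
exists g => [p|p]; last exact: gP.
by apply/eqP; rewrite -subr_eq0; apply/eqP/inj; rewrite diffopBr gP subrr.
Qed.

End ConstantCoefficientOperators.

(** * Transit operators *)

Section OneVariableTransit.
Variables (T : comNzRingType) (h : int -> T).
Implicit Types p q r : int.

(** One coordinate of a transit operator from [p] to [q]; truncating the
    difference at zero makes the steps upwards trivial. *)
Definition int_falling (p q : int) : T :=
  \prod_(k < absz (Num.max (p - q) 0)%R) h (p - k%:Z).

Lemma int_falling1 p q : p <= q -> int_falling p q = 1.
Proof.
by move=> pq; rewrite /int_falling (max_idPr _) ?subr_le0 // big_ord0.
Qed.

Lemma int_falling_cat p q r : r <= q -> q <= p ->
  int_falling p q * int_falling q r = int_falling p r.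
Proof.
move=> rq qp; rewrite /int_falling !(max_idPl _) ?subr_ge0 //; last exact: le_trans qp.
have [a ->] : exists a : nat, p = q + a%:Z by exists (absz (p - q)%R); lia.
have [b ->] : exists b : nat, q = r + b%:Z by exists (absz (q - r)%R); lia.
have -> : absz (r + b%:Z + a%:Z - (r + b%:Z))%R = a by lia.
have -> : absz (r + b%:Z - r)%R = b by lia.
have -> : absz (r + b%:Z + a%:Z - r)%R = (a + b)%N by lia.
rewrite big_split_ord /=; congr (_ * _).
by apply: eq_bigr => k _; congr (h _); lia.
Qed.

(** Whatever the order of the three integers, one of the two sides goes from the
    largest to the smallest in one step and the other in two. *)
Lemma int_falling_cocycle p q r :
  int_falling p q * int_falling q r * int_falling r p =
  int_falling q p * int_falling r q * int_falling p r.
Proof.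
wlog pq : p q r / p <= q => [H|].
  have [/H //|/ltW qp] := leP p q.
  by rewrite [LHS]mulrAC [RHS]mulrAC -H.
have [qr|rq] := leP q r.
  rewrite !(int_falling1 pq) (int_falling1 qr) (int_falling1 (le_trans pq qr)).
  by rewrite !mul1r mulr1 mulrC int_falling_cat.
have {}rq := ltW rq.
have [pr|rp] := leP p r.
  rewrite (int_falling1 pq) (int_falling1 rq) (int_falling1 pr).
  by rewrite !mul1r !mulr1 int_falling_cat.
have {}rp := ltW rp.
rewrite (int_falling1 pq) (int_falling1 rq) (int_falling1 rp).
by rewrite mul1r !mulr1 int_falling_cat.
Qed.

End OneVariableTransit.

Section Transit.
Variables (R : realType) (n : nat).
Local Notation C := R[i].
Local Notation S := {mpoly C[n]}.
Implicit Types (gamma : 'cV[C]_n) (u a b c : 'cV[int]_n).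

Lemma toCD u v : toC R (u + v) = toC R u + toC R v.
Proof. by rewrite /toC map_mxD. Qed.

Lemma toCB u v : toC R (u - v) = toC R u - toC R v.
Proof. by rewrite /toC map_mxB. Qed.

Lemma toC0 : toC R (0 : 'cV[int]_n) = 0.
Proof. by rewrite /toC map_mx0. Qed.

Lemma toC_inj : injective (@toC R n).
Proof.
move=> u v /matrixP e; apply/matrixP => i j.
by apply/eqP; have /eqP := e i j; rewrite !mxE eqr_int.
Qed.

Lemma intr_eq_nat (m : int) (k : nat) : (m%:~R = k%:R :> C) <-> m = k%:Z.
Proof. by split=> [|->//] /eqP; rewrite -[k%:R]/(k%:Z%:~R) eqr_int => /eqP. Qed.

Lemma natpart_int (m : int) : natpart (m%:~R : C) = absz (Num.max m 0)%R.
Proof.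
rewrite /natpart; case: xgetP => /= [k _ /intr_eq_nat -> //|no].
by case: m no => k // /(_ k) [].
Qed.

(** A common origin [lambda] turns the natural number part of a complex
    difference into integer arithmetic. *)
Lemma transitE lambda a b : transit (lambda + toC R b) (lambda + toC R a) =
  \prod_j int_falling (fun m => 'X_j + (lambda j 0 + m%:~R)%:MP) (a j 0) (b j 0) :> S.
Proof.
rewrite /transit /falling; apply: eq_bigr => j _.
rewrite mnmE !mxE opprD addrACA subrr add0r -intrB natpart_int.
by apply: eq_bigr => k _; rewrite intrB addrA.
Qed.

Lemma transit_pos_part gamma u :
  transit (gamma - toC R u) gamma = falling gamma (pos_part u).
Proof.
rewrite /transit; congr (falling gamma _); apply/mnmP => j.
by rewrite !mnmE !mxE opprB addrCA subrr addr0 natpart_int.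
Qed.

Lemma transit_cocycle lambda a b c (la := lambda + toC R a)
    (lb := lambda + toC R b) (lc := lambda + toC R c) :
  transit lb la * transit lc lb * transit la lc =
  transit la lb * transit lb lc * transit lc la.
Proof.
rewrite !transitE -!big_split /=; apply: eq_bigr => j _.
exact: int_falling_cocycle.
Qed.

Lemma dmonE (K : {set 'I_n}) : dmon R K = \prod_j 'X_j ^+ (j \in K).
Proof.
rewrite /dmon big_mkcond /=; apply: eq_bigr => j _.
by case: (j \in K); rewrite ?expr1 ?expr0.
Qed.

Lemma dmon_neq0 K : dmon R K != 0 :> S.
Proof. apply/prodf_neq0 => j _; apply/eqP => /(congr1 (mcoeff U_(j)%MM)) /eqP.
by rewrite mcoeffX mcoeff0 eqxx oner_eq0. Qed.

Lemma dmon_cocycle (I J K : {set 'I_n}) :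
  dmon R (J :\: I) * dmon R (K :\: J) * dmon R (I :\: K) =
  dmon R (I :\: J) * dmon R (J :\: K) * dmon R (K :\: I).
Proof.
rewrite !dmonE -!big_split /=; apply: eq_bigr => j _; rewrite -!exprD !inE.
by congr (_ ^+ _); case: (j \in I); case: (j \in J); case: (j \in K).
Qed.

Lemma nsuppP gamma j :
  reflect (exists m : nat, gamma j 0 = - m.+1%:R) (j \in nsupp gamma).
Proof. by rewrite inE; exact: asboolP. Qed.

(** The factor with zero constant term is the one at which [k] reaches [z]: it
    occurs at most once, and equals the variable itself. *)
Lemma falling_factor (z : C) (nu : nat) (j : 'I_n)
    (F := \prod_(k < nu) ('X_j + (z - k%:R)%:MP) : S) :
  ((forall k : nat, (k < nu)%N -> z != k%:R) -> F@_0%MM != 0) /\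
  (forall k : nat, (k < nu)%N -> z = k%:R ->
     exists2 q, F = q * 'X_j & q@_0%MM != 0).
Proof.
have fac (c : C) : ('X_j + c%:MP : S)@_0%MM = c.
  by rewrite mcoeffD mcoeffX mcoeffC eqxx mulr1 -mdeg_eq0 mdeg1 add0r.
split=> [h|k knu zk].
  rewrite /F rmorph_prod /=; apply/prodf_neq0 => k _.
  by rewrite fac subr_eq0 h.
exists (\prod_(i < nu | i != Ordinal knu) ('X_j + (k%:R - i%:R)%:MP)).
  by rewrite /F zk (bigD1 (Ordinal knu)) //= subrr rmorph0 addr0 mulrC.
rewrite rmorph_prod /=; apply/prodf_neq0 => i ik.
by rewrite fac subr_eq0 eqr_nat eq_sym.
Qed.

(** On the way down from [gamma], coordinate j contributes a factor without
    constant term exactly when it passes from a nonnegative integer to a negative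
    one, that is when j enters the negative support. *)
Lemma transit_ntransit_exists gamma u (gamma' := gamma - toC R u) :
  exists2 q : S,
    transit gamma' gamma = q * dmon R (nsupp gamma' :\: nsupp gamma) &
    q@_0%MM != 0.
Proof.
have e j : exists q : S,
  \prod_(k < pos_part u j) ('X_j + (gamma j 0 - k%:R)%:MP) =
     q * 'X_j ^+ (j \in nsupp gamma' :\: nsupp gamma) /\ q@_0%MM != 0.
  have [f1 f2] := falling_factor (gamma j 0) (pos_part u j) j.
  have g'E : gamma' j 0 = gamma j 0 - (u j 0)%:~R by rewrite !mxE.
  case: (boolP (_ \in _)); rewrite inE => jK.
    case/andP: jK => /nsuppP jI /nsuppP [m]; rewrite g'E => /eqP.
    rewrite subr_eq => /eqP e.
    have ze : gamma j 0 = (u j 0 - m.+1%:Z)%:~R by rewrite e intrB addrC.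
    have zge : 0 <= u j 0 - m.+1%:Z.
      case E : (u j 0 - m.+1%:Z) => [//|a]; case: jI; exists a.
      by rewrite ze E NegzE rmorphN.
    have knu : (absz (u j 0 - m.+1%:Z)%R < pos_part u j)%N by rewrite mnmE; lia.
    have [|q qE q0] := f2 _ knu; first by rewrite ze -[in LHS](gez0_abs zge).
    by exists q; rewrite expr1.
  exists (\prod_(k < pos_part u j) ('X_j + (gamma j 0 - k%:R)%:MP)).
  rewrite expr0 mulr1; split=> //; apply: f1 => k ku.
  apply: contraNneq jK => gk; apply/andP; split.
    apply/nsuppP => -[m]; rewrite gk => /eqP; apply/negP.
    by rewrite gt_eqF // (@lt_le_trans _ _ 0) ?oppr_lt0 ?ltr0Sn ?ler0n.
  move: ku; rewrite mnmE => ku; apply/nsuppP; exists (absz (u j 0)%R - k.+1)%N.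
  rewrite g'E gk -[k%:R]/(k%:Z%:~R) -intrB -[in RHS]natr1 -[RHS]/(- (_%:Z%:~R + 1%:~R)).
  by rewrite -intrD -intrN; congr (_%:~R); lia.
have [q qP] := choice e; exists (\prod_j q j).
  rewrite transit_pos_part /falling dmonE -big_split /=.
  by apply: eq_bigr => j _; case: (qP j).
by rewrite rmorph_prod; apply/prodf_neq0 => j _; case: (qP j).
Qed.

Lemma transit_ntransit gamma u (gamma' := gamma - toC R u) :
  transit gamma' gamma =
    ntransit gamma' gamma * dmon R (nsupp gamma' :\: nsupp gamma).
Proof.
have [q qE _] := transit_ntransit_exists gamma u.
exact: (@xgetI _ 0 [set q | transit gamma' gamma =
  q * dmon R (nsupp gamma' :\: nsupp gamma)] _ qE).
Qed.

Lemma ntransit_coef0 gamma u : (ntransit (gamma - toC R u) gamma)@_0%MM != 0.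
Proof.
have [q qE q0] := transit_ntransit_exists gamma u.
suff -> : ntransit (gamma - toC R u) gamma = q by [].
apply: (@mulIf _ (dmon R (nsupp (gamma - toC R u) :\: nsupp gamma))).
  exact: dmon_neq0.
by rewrite -qE -transit_ntransit.
Qed.

(** Both [transit] and the monomials [dmon] satisfy the cocycle identity, and the
    monomials can be cancelled. *)
Lemma ntransit_cocycle lambda a b c (la := lambda + toC R a)
    (lb := lambda + toC R b) (lc := lambda + toC R c) :
  ntransit lb la * ntransit lc lb * ntransit la lc =
  ntransit la lb * ntransit lb lc * ntransit lc la.
Proof.
have tE a' b' : transit (lambda + toC R b') (lambda + toC R a') =
    ntransit (lambda + toC R b') (lambda + toC R a') *
    dmon R (nsupp (lambda + toC R b') :\: nsupp (lambda + toC R a')).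
  rewrite (_ : lambda + toC R b' = lambda + toC R a' - toC R (a' - b')).
    exact: transit_ntransit.
  by rewrite toCB opprB addrA addrAC addrK addrC.
have := transit_cocycle lambda a b c.
cbv zeta; rewrite !tE -/la -/lb -/lc.
set D1 := dmon _ _; set D2 := dmon _ _; set D3 := dmon _ _.
set D4 := dmon _ _; set D5 := dmon _ _; set D6 := dmon _ _.
have D0 : D1 * D2 * D3 != 0 by rewrite !mulf_neq0 ?dmon_neq0.
have DE : D1 * D2 * D3 = D4 * D5 * D6 by exact: dmon_cocycle.
have AC (x1 x2 x3 y1 y2 y3 : S) :
  x1 * y1 * (x2 * y2) * (x3 * y3) = (x1 * x2 * x3) * (y1 * y2 * y3) by ring.
by rewrite !AC DE => /mulIf; apply; rewrite -DE.
Qed.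

End Transit.

(** * The hypergeometric ideal acting on series *)

Section WeylAction.
Variables (R : realType) (n : nat).
Local Notation C := R[i].
Local Notation S := {mpoly C[n]}.
Implicit Types (gamma : 'cV[C]_n) (phi psi : series n C) (p q : S) (m : 'X_{1..n}).

Lemma diffop_linear_factor (j : 'I_n) (c : C) p :
  diffop ('X_j + c%:MP) p = c *: p + mderiv j p.
Proof. by rewrite diffopDl diffopC diffopX mderivmU1m addrC. Qed.

Lemma weyl_act1 phi : weyl_act 1 phi = phi.
Proof. by rewrite -[1](rmorph1 (weyl_class n C)) weyl_actE free_act1. Qed.

Lemma weyl_act0 phi : weyl_act 0 phi = 0.
Proof. by rewrite -[0](rmorph0 (weyl_class n C)) weyl_actE free_act0l. Qed.

Lemma weyl_act0r (P : weyl n C) : weyl_act P 0 = 0.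
Proof.
have := weyl_act_linear P (-1) 0 0.
by rewrite scaler0 addr0 scaleN1r addNr.
Qed.

Lemma weyl_act_sum (I : Type) (r : seq I) (B : pred I) (G : I -> weyl n C) phi :
  weyl_act (\sum_(i <- r | B i) G i) phi =
  \sum_(i <- r | B i) weyl_act (G i) phi.
Proof.
apply: (big_morph (fun P => weyl_act P phi)); last exact: weyl_act0.
exact: weyl_actDl.
Qed.

Lemma weyl_actN (P : weyl n C) phi : weyl_act (- P) phi = - weyl_act P phi.
Proof.
apply/eqP; rewrite -addr_eq0; apply/eqP.
by rewrite -weyl_actDl addNr weyl_act0.
Qed.

Lemma weyl_actMz (P : weyl n C) (z : int) phi :
  weyl_act (P *~ z) phi = weyl_act P phi *~ z.
Proof.
have nat k : weyl_act (P *+ k) phi = weyl_act P phi *+ k.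
  by elim: k => [|k IH]; rewrite ?mulr0n ?weyl_act0 // !mulrS weyl_actDl IH.
by case: z => k; rewrite ?NegzE ?mulrNz -!pmulrn ?weyl_actN nat.
Qed.

Lemma seriesDE phi psi gamma : (phi + psi) gamma = phi gamma + psi gamma.
Proof. by []. Qed.

Lemma seriesZE (c : C) phi gamma : (c *: phi) gamma = c *: phi gamma.
Proof. by []. Qed.

Lemma seriesBE phi psi gamma : (phi - psi) gamma = phi gamma - psi gamma.
Proof. by []. Qed.

Lemma seriesMzE phi (z : int) gamma : (phi *~ z) gamma = phi gamma *~ z.
Proof.
have nat k : (phi *+ k) gamma = phi gamma *+ k.
  by elim: k => [|k IH]; rewrite ?mulr0n // !mulrS seriesDE IH.
by case: z => k; rewrite ?NegzE ?mulrNz -?pmulrn -?nat.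
Qed.

Lemma series_sumE (I : Type) (r : seq I) (B : pred I) (G : I -> series n C) gamma :
  (\sum_(i <- r | B i) G i) gamma = \sum_(i <- r | B i) G i gamma.
Proof. by apply: (big_morph (fun phi : series n C => phi gamma)). Qed.

Lemma weyl_actd_exp j k phi gamma :
  weyl_act (weyl_d C j ^+ k) phi gamma =
  diffop (\prod_(i < k) ('X_j + (gamma j 0 + k%:R - i%:R)%:MP))
    (phi (gamma + k%:R *: delta_mx j 0)).
Proof.
elim: k gamma => [|k IH] gamma.
  by rewrite expr0 weyl_act1 big_ord0 diffop1 scale0r addr0.
rewrite exprS weyl_actM weyl_actd !IH -diffop_linear_factor diffop_comp.
rewrite big_ord_recr /= [X in diffop X _ = _]mulrC; congr (diffop (_ * _) (phi _)).
- apply: eq_bigr => i _; rewrite !mxE !eqxx /= -[k.+1%:R]nat1r.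
  by rewrite [in RHS]addrA.
- by rewrite !mxE !eqxx /= -[k.+1%:R]nat1r [in RHS]addrA addrK.
- by rewrite -[k.+1%:R]nat1r scalerDl scale1r [in RHS]addrA.
Qed.

Definition mnm_vec (m : 'X_{1..n}) : 'cV[C]_n := \col_j (m j)%:R.

Lemma mnm_vecD m m' : mnm_vec (m + m')%MM = mnm_vec m + mnm_vec m'.
Proof. by apply/matrixP => j k; rewrite !mxE mnmDE natrD. Qed.

Lemma weyl_act_mon m phi gamma :
  weyl_act (\prod_j weyl_d C j ^+ m j) phi gamma =
  diffop (falling (gamma + mnm_vec m) m) (phi (gamma + mnm_vec m)).
Proof.
have gen (r : seq 'I_n) : uniq r -> forall gamma',
    weyl_act (\prod_(j <- r) weyl_d C j ^+ m j) phi gamma' =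
    diffop (\prod_(j <- r) \prod_(k < m j)
        ('X_j + (gamma' j 0 + (m j)%:R - k%:R)%:MP))
      (phi (gamma' + \sum_(j <- r) (m j)%:R *: delta_mx j 0)).
  elim: r => [|j r IH] /= => [_|/andP[jr ur]] gamma'.
    by rewrite !big_nil weyl_act1 diffop1 addr0.
  rewrite !big_cons weyl_actM weyl_actd_exp (IH ur) diffop_comp -addrA.
  rewrite [X in diffop (_ * X) _ = _](_ : _ = \prod_(i <- r) \prod_(k < m i)
    ('X_i + (gamma' i 0 + (m i)%:R - k%:R)%:MP)) //.
  rewrite !big_seq; apply: eq_bigr => i ir.
  apply: eq_bigr => k _; rewrite !mxE.
  have -> : (i == j) = false by apply: contraNF jr => /eqP <-.
  by rewrite mulr0 addr0.
have -> : mnm_vec m = \sum_j (m j)%:R *: delta_mx j 0.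
  apply/matrixP => i k; rewrite ord1 summxE (bigD1 i) //= big1 => [|j ji].
    by rewrite !mxE !eqxx mulr1 addr0.
  by rewrite !mxE eq_sym (negbTE ji) mulr0.
rewrite gen ?index_enum_uniq //; congr (diffop _ _).
rewrite /falling; apply: eq_bigr => j _; apply: eq_bigr => k _.
congr (_ + (_ - _)%:MP); rewrite !mxE summxE (bigD1 j) //= big1 => [|i ij].
  by rewrite !mxE !eqxx mulr1 addr0.
by rewrite !mxE eq_sym (negbTE ij) mulr0.
Qed.

(** The action of the monomial d/dx^m on the coefficients of a series. *)
Definition deriv_act m phi : series n C := fun gamma =>
  diffop (falling (gamma + mnm_vec m) m) (phi (gamma + mnm_vec m)).

Lemma weyl_of_polyE p phi gamma : weyl_act (weyl_of_poly p) phi gamma =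
  \sum_(m <- msupp p) p@_m *: deriv_act m phi gamma.
Proof.
rewrite weyl_act_sum series_sumE; apply: eq_bigr => m _.
by rewrite weyl_actM weyl_actC /deriv_act -weyl_act_mon.
Qed.

Lemma weyl_of_polywE k p phi gamma : (msize p <= k)%N ->
  weyl_act (weyl_of_poly p) phi gamma =
  \sum_(m : 'X_{1..n < k}) p@_m *: deriv_act m phi gamma.
Proof.
move=> pk; rewrite weyl_of_polyE (big_mksub 'X_{1..n < k}) /=; first last.
- by move=> m /msize_mdeg_lt/leq_trans/(_ pk).
- exact: msupp_uniq.
by rewrite big_rmcond //= => m /memN_msupp_eq0 ->; rewrite scale0r.
Qed.

Lemma weyl_of_polyD p q phi : weyl_act (weyl_of_poly (p + q)) phi =
  weyl_act (weyl_of_poly p) phi + weyl_act (weyl_of_poly q) phi.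
Proof.
apply/funext => gamma; pose k := maxn (msize (p + q)) (maxn (msize p) (msize q)).
have [k1 [k2 k3]] : (msize (p + q) <= k)%N /\ (msize p <= k)%N /\ (msize q <= k)%N.
  by rewrite !leq_max !leqnn !orbT.
rewrite [RHS]seriesDE.
rewrite [LHS](weyl_of_polywE phi gamma k1).
rewrite [X in _ = X + _](weyl_of_polywE phi gamma k2).
rewrite [X in _ = _ + X](weyl_of_polywE phi gamma k3) -big_split /=.
by apply: eq_bigr => m _; rewrite mcoeffD scalerDl.
Qed.

Lemma weyl_of_polyZ c p phi : weyl_act (weyl_of_poly (c *: p)) phi =
  c *: weyl_act (weyl_of_poly p) phi.
Proof.
apply/funext => gamma; rewrite [RHS]seriesZE.
rewrite [LHS](weyl_of_polywE phi gamma (msizeZ_le p c)).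
rewrite [X in _ = _ *: X](weyl_of_polywE phi gamma (leqnn (msize p))) scaler_sumr.
by apply: eq_bigr => m _; rewrite mcoeffZ scalerA.
Qed.

Lemma weyl_of_poly0 phi : weyl_act (weyl_of_poly 0) phi = 0.
Proof. by apply/funext => gamma; rewrite weyl_of_polyE msupp0 big_nil. Qed.

Lemma weyl_of_polyX m phi : weyl_act (weyl_of_poly 'X_[m]) phi = deriv_act m phi.
Proof.
by apply/funext => gamma; rewrite weyl_of_polyE msuppX big_seq1 mcoeffX eqxx scale1r.
Qed.

Lemma deriv_actD m phi psi :
  deriv_act m (phi + psi) = deriv_act m phi + deriv_act m psi.
Proof. by apply/funext => gamma; exact: diffopDr. Qed.

Lemma deriv_actZ m c phi : deriv_act m (c *: phi) = c *: deriv_act m phi.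
Proof. by apply/funext => gamma; exact: diffopZr. Qed.

Lemma deriv_act0 m : deriv_act m 0 = 0.
Proof. by apply/funext => gamma; exact: diffop0r. Qed.

Lemma falling_add gamma m m' :
  falling gamma (m + m')%MM = falling gamma m * falling (gamma - mnm_vec m) m'.
Proof.
rewrite /falling -big_split /=; apply: eq_bigr => j _.
rewrite mnmDE big_split_ord /=; congr (_ * _).
by apply: eq_bigr => k _; rewrite !mxE natrD opprD addrA.
Qed.

Lemma deriv_act_comp m m' phi :
  deriv_act m (deriv_act m' phi) = deriv_act (m + m')%MM phi.
Proof.
apply/funext => gamma; rewrite /deriv_act diffop_comp mnm_vecD !addrA.
congr (diffop _ _).
by rewrite [(m + m')%MM]addmC falling_add addrK mulrC.
Qed.

(** The composition rule of falling factorials makes the action of [weyl_of_poly]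
    multiplicative, whatever the order of the derivatives inside a monomial. *)
Lemma weyl_of_poly_monM m p phi : weyl_act (weyl_of_poly ('X_[m] * p)) phi =
  deriv_act m (weyl_act (weyl_of_poly p) phi).
Proof.
elim/mpolyind: p => [|c m' p _ _ IH].
  by rewrite mulr0 weyl_of_poly0 deriv_act0.
rewrite [in LHS]mulrDr [LHS]weyl_of_polyD [X in deriv_act m X]weyl_of_polyD.
rewrite [RHS]deriv_actD; apply: (congr2 +%R _ IH).
rewrite -scalerAr [LHS]weyl_of_polyZ [X in deriv_act m X]weyl_of_polyZ.
rewrite [RHS]deriv_actZ -mpolyXD [X in _ *: X = _]weyl_of_polyX.
by rewrite [X in deriv_act m X]weyl_of_polyX deriv_act_comp.
Qed.

Lemma weyl_of_polyM_eq0 p q phi : weyl_act (weyl_of_poly q) phi = 0 ->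
  weyl_act (weyl_of_poly (p * q)) phi = 0.
Proof.
move=> q0; elim/mpolyind: p => [|c m p _ _ IH].
  by rewrite mul0r weyl_of_poly0.
rewrite mulrDl [LHS]weyl_of_polyD [X in _ + X]IH addr0 -scalerAl.
rewrite [LHS]weyl_of_polyZ [X in _ *: X]weyl_of_poly_monM.
by rewrite [X in deriv_act m X]q0 deriv_act0 scaler0.
Qed.

Lemma euler_opE d (A : 'M[int]_(d, n)) (beta : 'cV[C]_d) i phi gamma :
  weyl_act (euler_op A beta i) phi gamma =
  ((map_mx intr A *m gamma) i 0 - beta i 0) *: phi gamma +
  diffop (Ady R A i) (phi gamma).
Proof.
rewrite /euler_op weyl_actDl weyl_actN weyl_actC weyl_act_sum.
rewrite [LHS]seriesBE [X in _ - X]seriesZE [X in X - _]series_sumE scalerBl addrAC; congr (_ - _).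
rewrite /Ady diffop_sum !mxE scaler_suml -big_split /=; apply: eq_bigr => j _.
rewrite [X in X gamma]weyl_actMz [LHS]seriesMzE [X in X gamma *~ _]weyl_actM.
rewrite [X in X *~ _]weyl_actx [X in X *~ _]weyl_actd.
rewrite subrK -['X_j *~ _](@scaler_int C) diffopZl diffopX mderivmU1m.
by rewrite -[LHS](@scaler_int C) scalerDr scalerA [in RHS]mxE.
Qed.

(** The toric ideal consists of polynomial multiples of the binomials, and
    multiplying by a monomial amounts to a further application of derivatives;
    hence the generators decide. *)
Lemma hyp_ideal_kills d (A : 'M[int]_(d, n)) (beta : 'cV[C]_d) phi :
  (forall P, hyp_ideal A beta P -> weyl_act P phi = 0) <->
  (forall u, kerZ A u ->
     deriv_act (pos_part u) phi = deriv_act (pos_part (- u)) phi) /\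
  (forall i, weyl_act (euler_op A beta i) phi = 0).
Proof.
have binom u : weyl_act (weyl_of_poly ('X_[pos_part u] - 'X_[pos_part (- u)])) phi
    = deriv_act (pos_part u) phi - deriv_act (pos_part (- u)) phi.
  rewrite -scaleN1r [LHS]weyl_of_polyD [X in _ + X]weyl_of_polyZ.
  by rewrite [X in X + _]weyl_of_polyX [X in _ *: X]weyl_of_polyX scaleN1r.
split=> [h|[ht he] P [s sG ->]].
  split=> [u uA|i]; last by apply: h; apply: span_gen; right; exists i.
  apply/eqP; rewrite -subr_eq0 -binom; apply/eqP/h/span_gen; left.
  exists ('X_[pos_part u] - 'X_[pos_part (- u)]) => //.
  by apply: span_gen; exists u.
rewrite weyl_act_sum big_seq big1 // => -[a g] /sG /= Gg.
rewrite [a *: g]/(a * g) weyl_actM.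
suff -> : weyl_act g phi = 0 by rewrite weyl_act0r.
case: Gg => [[p [t tG ->] <-]|[i _ <-]]; last exact: he.
elim: t tG => [|[b q] t IH] tG; first by rewrite big_nil weyl_of_poly0.
rewrite big_cons [LHS]weyl_of_polyD [X in _ + X]IH ?addr0 => [|x xt]; last first.
  by apply: tG; rewrite inE xt orbT.
have [u uA /= <-] := tG _ (mem_head _ _).
by apply: weyl_of_polyM_eq0; rewrite binom ht // subrr.
Qed.

End WeylAction.

(** * Normalised coefficients *)

Section OperatorAlgebra.
Variables (T : comNzRingType) (V : lmodType T).

(** The algebra behind the normalisation, for points a, b and the reference c:
    [ba] stands for the normalised transit to b from a, [D] and [E] for the
    monomials, [pa] and [pb] for coefficients of a series and [qa] and [qb] for the
    rescaled ones.  Stated in an abstract module, where products stay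
    symbolic. *)
Lemma normalized_relation (ba cb ac ab bc ca D E : T) (pa pb qa qb : V) :
  ba * cb * ac = ab * bc * ca ->
  ca *: pa = ac *: qa -> cb *: pb = bc *: qb ->
  (forall v v' : V, (ca * cb) *: v = (ca * cb) *: v' -> v = v') ->
  (forall v v' : V, (ba * cb * ac) *: v = (ba * cb * ac) *: v' -> v = v') ->
  (ba * D) *: pa = (ab * E) *: pb <-> D *: qa = E *: qb.
Proof.
move=> cocycle ea eb inj1 inj2.
have ha : (ca * cb) *: ((ba * D) *: pa) = (ba * cb * ac) *: (D *: qa).
  rewrite scalerA (_ : ca * cb * (ba * D) = ba * cb * D * ca); last by ring.
  by rewrite -scalerA ea !scalerA; congr (_ *: _); ring.
have hb : (ca * cb) *: ((ab * E) *: pb) = (ba * cb * ac) *: (E *: qb).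
  rewrite cocycle scalerA (_ : ca * cb * (ab * E) = ca * ab * E * cb); last by ring.
  by rewrite -scalerA eb !scalerA; congr (_ *: _); ring.
by split=> e; [apply: inj2; rewrite -ha -hb e|apply: inj1; rewrite ha hb e].
Qed.

(** A rescaled coefficient found at b serves at a too, if the transit equation
    between a and b involves invertible operators only. *)
Lemma normalized_transport (ba cb ac ab bc ca : T) (pa pb q : V) :
  ba * cb * ac = ab * bc * ca ->
  bc *: q = cb *: pb -> ba *: pa = ab *: pb ->
  (forall v v' : V, (ba * cb) *: v = (ba * cb) *: v' -> v = v') ->
  ca *: pa = ac *: q.
Proof.
move=> cocycle eb e inj; apply: inj; rewrite [RHS]scalerA cocycle.
rewrite (_ : ab * bc * ca = ab * ca * bc); last by ring.
rewrite -[RHS]scalerA eb [RHS]scalerA (_ : ab * ca * cb = ca * cb * ab); last by ring.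
by rewrite -[RHS]scalerA -e !scalerA; congr (_ *: _); ring.
Qed.

Lemma normalized_scale (a b D : T) (p q : V) :
  a *: p = b *: q -> a *: (D *: p) = b *: (D *: q).
Proof. by move=> e; rewrite !scalerA ![_ * D]mulrC -!scalerA e. Qed.

End OperatorAlgebra.

Section LatticeSolutions.
Variables (R : realType) (d n : nat) (A : 'M[int]_(d, n)).
Local Notation C := R[i].
Local Notation S := {mpoly C[n]}.
Variables (beta : 'cV[C]_d) (Lam : set 'cV[C]_n).
Hypothesis LamP : is_exp_lattice A beta Lam.
Implicit Types (gamma lambda : 'cV[C]_n) (phi : series n C).

Lemma diffop_inj (q p p' : S) :
  q@_0%MM != 0 -> diffop q p = diffop q p' -> p = p'.
Proof. by move=> /diffop_bij/bij_inj; apply. Qed.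

Lemma diffop_eq0_iff (q q' p p' : S) : q@_0%MM != 0 -> q'@_0%MM != 0 ->
  diffop q p = diffop q' p' -> (p = 0 <-> p' = 0).
Proof.
move=> q0 q0' e; split=> p0; [apply: (diffop_inj q0')|apply: (diffop_inj q0)].
  by rewrite -e p0 !diffop0r.
by rewrite e p0 !diffop0r.
Qed.

Lemma op_invK (q p : S) : q@_0%MM != 0 -> diffop q (op_inv q p) = p.
Proof.
move=> /diffop_bij[g _ gK].
exact: (@xgetI _ 0 [set r : dpoly n C | q *: r = p] (g p) (gK p)).
Qed.

Lemma kerZN (u : 'cV[int]_n) : kerZ A u -> kerZ A (- u).
Proof. by rewrite /kerZ /= mulmxN => ->; rewrite oppr0. Qed.

Lemma kerZD (u v : 'cV[int]_n) : kerZ A u -> kerZ A v -> kerZ A (u + v).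
Proof. by rewrite /kerZ /= mulmxDr => -> ->; rewrite addr0. Qed.

Lemma toCN (u : 'cV[int]_n) : toC R (- u) = - toC R u.
Proof. by rewrite /toC map_mxN. Qed.

Lemma lattice_shift gamma u : Lam gamma -> kerZ A u -> Lam (gamma + toC R u).
Proof.
case: LamP => lam _ -> [v vA <-] uA; exists (v + u); first exact: kerZD.
by rewrite toCD addrA.
Qed.

Lemma lattice_diff gamma gamma' : Lam gamma -> Lam gamma' ->
  exists2 u, kerZ A u & gamma' = gamma + toC R u.
Proof.
case: LamP => lam _ -> [v vA <-] [v' v'A <-]; exists (v' - v).
  exact/kerZD/kerZN.
by rewrite toCB addrACA subrr addr0.
Qed.

Lemma lattice_eq gamma : Lam gamma -> map_mx intr A *m gamma = beta.
Proof.
case: LamP => lam <- -> [u uA <-]; rewrite mulmxDr /toC -map_mxM /=.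
by rewrite uA map_mx0 addr0.
Qed.

Lemma ntransit_unit gamma gamma' : Lam gamma -> Lam gamma' ->
  (ntransit gamma' gamma)@_0%MM != 0.
Proof.
move=> Lg Lg'; have [u _ e] := lattice_diff Lg' Lg.
have -> : gamma' = gamma - toC R u by rewrite e addrK.
exact: ntransit_coef0.
Qed.

Lemma lattice_transit gamma gamma' : Lam gamma -> Lam gamma' ->
  transit gamma' gamma =
    ntransit gamma' gamma * dmon R (nsupp gamma' :\: nsupp gamma).
Proof.
move=> Lg Lg'; have [u _ e] := lattice_diff Lg' Lg.
have -> : gamma' = gamma - toC R u by rewrite e addrK.
exact: transit_ntransit.
Qed.

Lemma lattice_cocycle g1 g2 g3 : Lam g1 -> Lam g2 -> Lam g3 ->
  ntransit g2 g1 * ntransit g3 g2 * ntransit g1 g3 =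
  ntransit g1 g2 * ntransit g2 g3 * ntransit g3 g1.
Proof.
move=> L1 L2 L3; have [u _ e2] := lattice_diff L1 L2.
have [v _ e3] := lattice_diff L1 L3.
have e1 : g1 = g1 + toC R 0 by rewrite toC0 addr0.
have := ntransit_cocycle g1 0 u v; cbv zeta.
by rewrite -e1 -e2 -e3.
Qed.

Lemma mnm_vec_pos_part (u : 'cV[int]_n) :
  mnm_vec R (pos_part u) - mnm_vec R (pos_part (- u)) = toC R u.
Proof.
apply/matrixP => j k; rewrite ord1 !mxE !mnmE !mxE.
rewrite -[(absz _)%:R]/((absz _)%:Z%:~R) -[X in _ - X]/((absz _)%:Z%:~R) -intrB.
congr (_%:~R); case: (u j 0) => m; rewrite ?NegzE ?opprK; lia.
Qed.

Lemma deriv_act_pos_part (u : 'cV[int]_n) phi gamma :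
  deriv_act (pos_part u) phi (gamma - mnm_vec R (pos_part u)) =
  diffop (transit (gamma - toC R u) gamma) (phi gamma).
Proof. by rewrite /deriv_act subrK transit_pos_part. Qed.

Definition transit_system phi := forall gamma gamma', Lam gamma -> Lam gamma' ->
  diffop (transit gamma' gamma) (phi gamma) =
  diffop (transit gamma gamma') (phi gamma').

(** The binomial for u relates the exponents that differ by u, and any two points
    of the lattice do so for some u in L; on the lattice the scalar part of the
    Euler operators vanishes since A gamma = beta. *)
Lemma hyp_ideal_lattice phi : Supp phi `<=` Lam ->
  (forall P, hyp_ideal A beta P -> weyl_act P phi = 0) <->
  transit_system phi /\
  forall i gamma, Lam gamma -> diffop (Ady R A i) (phi gamma) = 0.
Proof.
move=> phiL; rewrite hyp_ideal_kills.
have out gamma : ~ Lam gamma -> phi gamma = 0.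
  by move=> nL; apply/eqP; apply: contra_notT nL => /phiL.
split=> -[ht he]; split.
- move=> gamma gamma' Lg Lg'; have [u uA e] := lattice_diff Lg' Lg.
  have e' : gamma' = gamma - toC R u by rewrite e addrK.
  have e2 : gamma - mnm_vec R (pos_part u) = gamma' - mnm_vec R (pos_part (- u)).
    by rewrite e -mnm_vec_pos_part addrA addrAC addrK.
  have := congr1 (fun f : series n C => f (gamma - mnm_vec R (pos_part u))) (ht u uA).
  rewrite deriv_act_pos_part e2 deriv_act_pos_part -e'.
  by rewrite toCN opprK -e.
- move=> i gamma Lg.
  have := congr1 (fun f : series n C => f gamma) (he i); rewrite euler_opE.
  by rewrite (lattice_eq Lg) subrr scale0r add0r.
- move=> u uA; apply/funext => gamma0.
  pose gamma := gamma0 + mnm_vec R (pos_part u).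
  pose gamma' := gamma0 + mnm_vec R (pos_part (- u)).
  have e : gamma = gamma' + toC R u.
    by rewrite /gamma /gamma' -mnm_vec_pos_part -addrA [X in _ = _ + X]addrC subrK.
  have e' : gamma' = gamma - toC R u by rewrite e addrK.
  have -> : deriv_act (pos_part u) phi gamma0 =
      diffop (transit gamma' gamma) (phi gamma).
    by rewrite e' -deriv_act_pos_part /gamma addrK.
  have -> : deriv_act (pos_part (- u)) phi gamma0 =
      diffop (transit gamma gamma') (phi gamma').
    rewrite e -[toC R u]opprK -toCN -deriv_act_pos_part /gamma' addrK //.
  have [Lg|Lg] := pselect (Lam gamma).
    by apply: ht => //; rewrite e' -toCN; apply: lattice_shift => //; exact: kerZN.
  rewrite !out ?diffop0r // => Lg'.
  by apply: Lg; rewrite e; exact: lattice_shift.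
- move=> i; apply/funext => gamma; rewrite euler_opE.
  have [Lg|/out ->] := pselect (Lam gamma).
    by rewrite (lattice_eq Lg) subrr scale0r add0r he.
  by rewrite scaler0 diffop0r addr0.
Qed.

Variables (lambda : 'cV[C]_n) (Llam : Lam lambda).

(** The relation between a series and its family of normalised coefficients,
    stated without inverting operators. *)
Definition normalized phi (c : {set 'I_n} -> S) := forall gamma, Lam gamma ->
  diffop (ntransit lambda gamma) (phi gamma) =
  diffop (ntransit gamma lambda) (c (nsupp gamma)).

Definition compatible (c : {set 'I_n} -> S) := forall I J, NS Lam I -> NS Lam J ->
  diffop (dmon R (J :\: I)) (c I) = diffop (dmon R (I :\: J)) (c J).

Lemma normalized_compatible phi c : normalized phi c ->
  transit_system phi <-> compatible c.
Proof.
move=> cE.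
have unit2 g1 g2 g3 g4 : Lam g1 -> Lam g2 -> Lam g3 -> Lam g4 ->
    (ntransit g1 g2 * ntransit g3 g4)@_0%MM != 0.
  by move=> *; rewrite rmorphM mulf_neq0 // ntransit_unit.
have unit3 g1 g2 g3 g4 g5 g6 : Lam g1 -> Lam g2 -> Lam g3 -> Lam g4 ->
    Lam g5 -> Lam g6 ->
    (ntransit g1 g2 * ntransit g3 g4 * ntransit g5 g6)@_0%MM != 0.
  by move=> *; rewrite rmorphM mulf_neq0 ?unit2 ?ntransit_unit.
have H g g' : Lam g -> Lam g' ->
    diffop (transit g' g) (phi g) = diffop (transit g g') (phi g') <->
    diffop (dmon R (nsupp g' :\: nsupp g)) (c (nsupp g)) =
    diffop (dmon R (nsupp g :\: nsupp g')) (c (nsupp g')).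
  move=> Lg Lg'; rewrite (lattice_transit Lg Lg') (lattice_transit Lg' Lg).
  apply: (@normalized_relation _ (dpoly n C) _ _ _ _ _ _ _ _ _ _ _ _
    (lattice_cocycle Lg Lg' Llam) (cE g Lg) (cE g' Lg')).
    by move=> v v'; apply: diffop_inj; exact: unit2.
  by move=> v v'; apply: diffop_inj; exact: unit3.
split=> [h I J [g [Lg <-]] [g' [Lg' <-]]|h g g' Lg Lg'].
  by apply/(H g g' Lg Lg'); exact: h.
by apply/(H g g' Lg Lg'); apply: h; [exists g|exists g'].
Qed.

Lemma normalized_Ady phi c i : normalized phi c ->
  (forall gamma, Lam gamma -> diffop (Ady R A i) (phi gamma) = 0) <->
  (forall I, NS Lam I -> diffop (Ady R A i) (c I) = 0).
Proof.
move=> cE.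
have H g : Lam g ->
    diffop (ntransit lambda g) (diffop (Ady R A i) (phi g)) =
    diffop (ntransit g lambda) (diffop (Ady R A i) (c (nsupp g))).
  by move=> Lg; exact: (@normalized_scale _ (dpoly n C) _ _ _ _ _ (cE g Lg)).
have H0 g (Lg : Lam g) := diffop_eq0_iff (ntransit_unit Lg Llam)
  (ntransit_unit Llam Lg) (H g Lg).
split=> [h I [g [Lg <-]]|h g Lg]; first by apply/(H0 g Lg); exact: h.
by apply/(H0 g Lg)/h; exists g.
Qed.

Lemma normalized_eq0 phi c gamma : normalized phi c -> Lam gamma ->
  (phi gamma = 0 <-> c (nsupp gamma) = 0).
Proof.
move=> cE Lg.
exact: diffop_eq0_iff (ntransit_unit Lg Llam) (ntransit_unit Llam Lg) (cE _ Lg).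
Qed.

(** The rescaled coefficient is read off at one chosen point of each stratum;
    between two points of a stratum the monomials of the transit equation are
    trivial, so that the choice does not matter. *)
Lemma normalized_exists phi : transit_system phi -> exists c, normalized phi c.
Proof.
move=> h; pose g I := xget lambda (stratum Lam I).
have gP I : NS Lam I -> Lam (g I) /\ nsupp (g I) = I by exact: xgetPex.
exists (fun I => op_inv (ntransit (g I) lambda)
                   (diffop (ntransit lambda (g I)) (phi (g I)))).
move=> a La; set I := nsupp a.
have [Lb Ib] : Lam (g I) /\ nsupp (g I) = I by apply: gP; exists a.
set b := g I in Lb Ib *; set cI := op_inv _ _.
have e1 : diffop (ntransit b lambda) cI = diffop (ntransit lambda b) (phi b).
  by apply: op_invK; exact: ntransit_unit.
have e2 : diffop (ntransit b a) (phi a) = diffop (ntransit a b) (phi b).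
  have := h _ _ La Lb.
  rewrite [X in diffop X _ = _](lattice_transit La Lb).
  rewrite [X in _ = diffop X _](lattice_transit Lb La).
  by rewrite Ib finset.setDv /dmon big_set0 !mulr1.
apply: (@normalized_transport _ (dpoly n C) _ _ _ _ _ _ _ _ _
  (lattice_cocycle La Lb Llam) e1 e2) => v v'.
by apply: diffop_inj; rewrite rmorphM mulf_neq0 // ntransit_unit.
Qed.

End LatticeSolutions.

(** * Minima along the direction *)

Section MonotoneMinimum.
Variable R : realDomainType.

Definition has_minimum T (X : set T) (g : T -> R) :=
  exists2 x, X x & forall y, X y -> g x <= g y.

Lemma bigcup_has_minimum (I : finType) T (X : I -> set T) (g : T -> R) :
  (forall i, X i !=set0 -> has_minimum (X i) g) ->
  (exists i, X i !=set0) -> has_minimum [set x | exists i, X i x] g.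
Proof.
move=> Xmin [i0 X0].
have /choice[m mP] i : exists o : option T, if o is Some x then
    X i x /\ (forall y, X i y -> g x <= g y) else ~ (X i !=set0).
  have [/Xmin[x Xx xmin]|nX] := pselect (X i !=set0); first by exists (Some x).
  by exists None.
have [x0 mi0] : exists x, m i0 = Some x.
  by move: (mP i0); case: (m i0) => [x _|//]; exists x.
pose P i := m i : bool; pose v i := if m i is Some x then g x else 0.
have Pi0 : P i0 by rewrite /P mi0.
case: (arg_minP v Pi0) => i; rewrite /P /v; case mi: (m i) => [x|//] _ xmin.
have := mP i; rewrite mi => -[Xx xmin'].
exists x; first by exists i.
move=> y [j Xy]; have := mP j; case mj: (m j) => [z|].
  by case=> _ /(_ _ Xy); apply: le_trans; have := xmin j; rewrite mj; apply.
by case; exists y.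
Qed.

(** Dickson's lemma, as a statement on a quantity that is monotone for the
    componentwise order of vectors of natural numbers.  The induction is on the
    number of coordinates that are not constant on [X]: a point is either above a
    given [x0] or in one of finitely many slices with one more constant
    coordinate. *)
Lemma dickson_minimum n T (X : set T) (f : T -> 'I_n -> nat) (g : T -> R) :
  (forall x y, X x -> X y -> (forall j, (f x j <= f y j)%N) -> g x <= g y) ->
  X !=set0 -> has_minimum X g.
Proof.
suff gen (J : {set 'I_n}) k : (#|J| <= k)%N -> forall X : set T,
    (forall x y j, X x -> X y -> j \notin J -> f x j = f y j) ->
    (forall x y, X x -> X y -> (forall j, (f x j <= f y j)%N) -> g x <= g y) ->
    X !=set0 -> has_minimum X g.
  by apply: (gen finset.setT n) => [|x y j _ _]; rewrite ?cardsT ?card_ord ?inE.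
elim: k J {X} => [|k IH] J Jk X Xcst Xmon [x0 X0].
  move: Jk; rewrite leqn0 cards_eq0 => /eqP J0; exists x0 => // y Xy.
  by apply: Xmon => // j; rewrite (Xcst x0 y) // J0 inE.
(* [B] bounds every value that is smaller than a coordinate of [x0]. *)
pose B := \sum_j f x0 j.
pose slice (o : option ('I_n * 'I_B)) : set T := if o is Some (j, v)
  then [set x | [/\ X x, j \in J & f x j = v]] else [set x0].
have [] := @bigcup_has_minimum (option ('I_n * 'I_B)) T slice g _ _.
- case=> [[j v]|] [y yX] /=; last by exists x0 => // z ->.
  have jJ : j \in J by case: yX.
  apply: (IH (J :\ j)%SET).
  + by move: Jk; rewrite (cardsD1 j) jJ.
  + move=> x z i [Xx _ fx] [Xz _ fz]; rewrite !inE negb_and negbK.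
    by case/orP=> [/eqP ->|]; [rewrite fx fz|exact: Xcst].
  + by move=> x z [Xx _ _] [Xz _ _]; exact: Xmon.
  + by exists y.
- by exists None, x0.
move=> x [o sx] xmin; have Xx : X x by case: o sx => [[j v] []|->].
exists x => // y Xy; have [le|] := pselect (forall j, (f x0 j <= f y j)%N).
  by apply: (le_trans (xmin x0 _)); [exists None|exact: Xmon].
move=> /existsNP[j] /negP; rewrite -ltnNge => lt; apply: xmin.
have vB : (f y j < B)%N by rewrite (leq_trans lt) // /B (bigD1 j) //= leq_addr.
exists (Some (j, Ordinal vB)); split=> //=.
by apply: contraLR lt => jJ; rewrite (Xcst y x0) // ltnn.
Qed.

End MonotoneMinimum.

Section Direction.
Variables (R : realType) (d n : nat) (A : 'M[int]_(d, n)) (w : 'cV[R]_n).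
Local Notation C := R[i].
Local Notation S := {mpoly C[n]}.
Implicit Types (gamma : 'cV[C]_n) (u : 'cV[int]_n) (I J K : {set 'I_n}).

Definition weight u : R := \sum_j w j 0 * (u j 0)%:~R.

Lemma weightB u v : weight (u - v) = weight u - weight v.
Proof.
by rewrite /weight -sumrB; apply: eq_bigr => j _; rewrite !mxE intrB mulrBr.
Qed.

Lemma weightMn u t : weight (u *+ t) = weight u *+ t.
Proof.
rewrite /weight -sumrMnl; apply: eq_bigr => j _.
by rewrite mulmxnE rmorphMn mulrnAr.
Qed.

Lemma wdot_toC u : wdot w (toC R u) = (weight u)%:C%C.
Proof.
rewrite /wdot /weight rmorph_sum; apply: eq_bigr => j _.
by rewrite !mxE rmorphM /= rmorph_int.
Qed.

Lemma nsupp_int gamma j (m : int) :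
  gamma j 0 = m%:~R -> (j \in nsupp gamma) = (m < 0).
Proof.
move=> gE; apply/nsuppP/idP => [[k]|]; rewrite gE.
  rewrite -[_.+1%:R]/(_.+1%:Z%:~R) -intrN => /eqP; rewrite eqr_int => /eqP ->.
  by rewrite oppr_lt0.
by case: m {gE} => // k _; exists k; rewrite NegzE intrN.
Qed.

Definition is_int (z : C) := exists m : int, z = m%:~R.

Lemma nsupp_nonint gamma j : ~ is_int (gamma j 0) -> (j \in nsupp gamma) = false.
Proof.
move=> ng; apply/nsuppP => -[k gE]; apply: ng; exists (- k.+1%:Z).
by rewrite gE intrN.
Qed.

Lemma is_intD (z : C) (m : int) : is_int (z + m%:~R) <-> is_int z.
Proof.
split=> -[k kE]; last by exists (k + m); rewrite kE intrD.
by exists (k - m); rewrite intrB -kE addrK.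
Qed.

(** The condition says that [u] points away from the walls of the stratum of
    [gamma], so that no integral coordinate passes between the negative and the
    nonnegative integers. *)
Lemma nsupp_recession gamma u (t : nat) :
  (forall j (m : int), gamma j 0 = m%:~R -> if m < 0 then u j 0 <= 0 else 0 <= u j 0) ->
  nsupp (gamma + toC R (u *+ t)) = nsupp gamma.
Proof.
move=> h; apply/setP => j.
have gE : (gamma + toC R (u *+ t)) j 0 = gamma j 0 + (u j 0 *+ t)%:~R.
  by rewrite !mxE mulmxnE.
have [[m mE]|ng] := pselect (is_int (gamma j 0)).
  rewrite (nsupp_int mE) (@nsupp_int _ _ (m + u j 0 *+ t)); last first.
    by rewrite gE mE intrD.
  have := h j m mE; rewrite -mulr_natr; case: ltP => m0 u0; nia.
by rewrite !nsupp_nonint // gE is_intD.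
Qed.

Variables (beta : 'cV[C]_d) (Lam : set 'cV[C]_n).
Hypothesis LamP : is_exp_lattice A beta Lam.

Lemma le_dir_shift gamma u : le_dir w gamma (gamma + toC R u) <-> 0 <= weight u.
Proof. by rewrite /le_dir addrAC subrr add0r wdot_toC ler0c. Qed.

Lemma bounded_dirP I gamma0 : Lam gamma0 -> bounded_dir w Lam I -> exists b : R,
  forall u, stratum Lam I (gamma0 + toC R u) -> b <= weight u.
Proof.
move=> L0 [_ [lam Ll [b bP]]]; have [v vA lE] := lattice_diff LamP L0 Ll.
exists (b + weight v) => u su; have := bP _ su.
rewrite lE opprD addrACA subrr add0r -toCB wdot_toC lecR.
by rewrite weightB lerBrDr.
Qed.

(** Otherwise the translates by multiples of [u], which stay in the stratum, have
    weights tending to minus infinity. *)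
Lemma recession_weight_ge0 I gamma u : bounded_dir w Lam I -> stratum Lam I gamma ->
  kerZ A u ->
  (forall j (m : int), gamma j 0 = m%:~R -> if m < 0 then u j 0 <= 0 else 0 <= u j 0) ->
  0 <= weight u.
Proof.
move=> bI [Lg gI] uA h; have [b bP] := bounded_dirP Lg bI.
have hb t : b <= weight u *+ t.
  rewrite -weightMn; apply: bP; split; last by rewrite nsupp_recession.
  apply: (lattice_shift LamP) => //; rewrite /kerZ /=.
  by elim: t => [|t IH]; rewrite ?mulr0n ?mulmx0 // mulrS mulmxDr uA IH addr0.
rewrite leNgt; apply/negP => u0.
have b0 : b <= 0 by have := hb 0%N; rewrite mulr0n.
have : 0 <= b / weight u by rewrite mulr_le0 // invr_le0 ltW.
move=> /archi_boundP; set t := Num.bound _; rewrite ltr_ndivrMr // mulr_natl.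
by rewrite ltNge hb.
Qed.

(** Inside a stratum the signs of the integral coordinates are fixed, so the order
    of their absolute values decides whether the difference of two points is a
    recession vector; Dickson's lemma applies to these absolute values. *)
Lemma stratum_has_minimum I : bounded_dir w Lam I ->
  exists2 gamma, stratum Lam I gamma &
    forall gamma', stratum Lam I gamma' -> le_dir w gamma gamma'.
Proof.
move=> bI; have [[g0 s0] _] := bI; have [L0 _] := s0.
pose X : set 'cV[int]_n := [set u | kerZ A u /\ stratum Lam I (g0 + toC R u)].
(* At the coordinates that are not integers [absint] is a constant. *)
pose absint (z : C) := absz (xget 0 [set m : int | z = m%:~R]).
have absintE (m : int) : absint m%:~R = absz m.
  rewrite /absint; congr absz; apply: xget_unique => // k /eqP.
  by rewrite eqr_int eq_sym => /eqP.
pose f u (j : 'I_n) := absint ((g0 + toC R u) j 0).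
have [||u [uA su] umin] := @dickson_minimum R n _ X f weight.
- move=> u v [uA su] [vA sv] fuv.
  rewrite -subr_ge0 -weightB.
  apply: (recession_weight_ge0 bI su); first exact/kerZD/kerZN.
  move=> j m mE; have := fuv j; rewrite /f mE absintE.
  have vE : (g0 + toC R v) j 0 = (m + (v - u) j 0)%:~R.
    by rewrite intrD -mE !mxE intrB addrA addrAC addrK.
  have := nsupp_int mE; rewrite su.2 -sv.2 (nsupp_int vE) vE absintE.
  by move: ((v - u) j 0) => z; case: (ltP m 0); case: (ltP (m + z) 0) => // *; lia.
- by exists 0; split; [rewrite /kerZ /= mulmx0|rewrite toC0 addr0].
exists (g0 + toC R u) => // g [Lg gI].
have [v vA gE] := lattice_diff LamP L0 Lg.
have -> : g = g0 + toC R u + toC R (v - u) by rewrite gE toCB addrA addrAC addrK.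
apply/le_dir_shift; rewrite weightB subr_ge0.
by apply: umin; rewrite /X /= -gE.
Qed.

End Direction.

(** * Homomorphisms as families *)

Section QuotientMap.
Variables (T : pzRingType) (V W : lmodType T) (G : set V) (f : {linear V -> W}).
Hypothesis fG : forall v, G v -> f v = 0.

Lemma linear_span_eq0 v : Defs.span G v -> f v = 0.
Proof.
case=> s sG ->; rewrite linear_sum big_seq big1 // => p ps.
by rewrite linearZ /= fG ?scaler0 //; exact: sG.
Qed.

Definition quot_lift (q : quot_mod G) : W := f (repr q).

Lemma quot_liftE v : quot_lift (quot_class G v) = f v.
Proof.
apply/eqP; rewrite -subr_eq0 -linearB; apply/eqP/linear_span_eq0.
by apply/quot_classE; rewrite quot_class_surj.
Qed.

Lemma quot_lift_linear : linear quot_lift.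
Proof.
move=> a q r; rewrite -(quot_class_surj q) -(quot_class_surj r).
by rewrite -linearP !quot_liftE linearP.
Qed.

Lemma quot_lift_exists :
  exists g : {linear quot_mod G -> W}, forall v, g (quot_class G v) = f v.
Proof.
pose m := GRing.isLinear.Build T (quot_mod G) W _ quot_lift quot_lift_linear.
pose g : {linear quot_mod G -> W} := HB.pack quot_lift m.
by exists g; exact: quot_liftE.
Qed.

End QuotientMap.

Section DirectionModule.
Variables (R : realType) (d n : nat) (A : 'M[int]_(d, n)) (w : 'cV[R]_n).
Local Notation C := R[i].
Local Notation S := {mpoly C[n]}.
Variable Lam : set 'cV[C]_n.
Implicit Types (I J K : {set 'I_n}) (c : {set 'I_n} -> S).

Definition admissible_family c := forall K, NS Lam K -> ~ adm_dir w Lam K -> c K = 0.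

Lemma family_of_hom (psi : homS (Mdir A w Lam)) (c := fun I => psi (ebar A w Lam I) : S) :
  [/\ forall i I, NS Lam I -> diffop (Ady R A i) (c I) = 0,
      compatible Lam c & admissible_family c].
Proof.
have psi_rel v : Mdir_rel A w v -> psi (quot_class (Mdir_rel A w (Lam:=Lam)) v) = 0.
  move=> rv; rewrite -[RHS](linear0 psi) -(linear0 (quot_class (Mdir_rel A w (Lam:=Lam)))).
  by congr (psi _); apply/quot_classE; rewrite subr0; exact: span_gen.
have psiZ p I : psi (quot_class (Mdir_rel A w (Lam:=Lam)) (p *: estar Lam I)) =
    diffop p (c I).
  by rewrite linearZ /= linearZ.
split.
- move=> i I NI; rewrite -psiZ; apply: psi_rel.
  by constructor 1; exists i, I.
- move=> I J NI NJ; apply/eqP; rewrite -subr_eq0 -!psiZ -linearB -linearB.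
  by apply/eqP/psi_rel; constructor 2; exists I, J.
- by move=> K NK nK; apply: psi_rel; constructor 3; exists K.
Qed.

Lemma afree_sum (v : Afree Lam) :
  v = \sum_(J : NS_type Lam) (v J : S) *: estar Lam (val J).
Proof.
apply/ffunP => J; rewrite sum_ffunE (bigD1 J) //= big1 => [|K KJ].
  by rewrite !ffunE eqxx addr0; exact/esym/mulr1.
rewrite !ffunE (inj_eq val_inj) eq_sym (negbTE KJ); exact: mulr0.
Qed.

Lemma hom_ext (psi psi' : homS (Mdir A w Lam)) :
  (forall I, NS Lam I -> psi (ebar A w Lam I) = psi' (ebar A w Lam I)) ->
  psi = psi'.
Proof.
move=> e; apply: homSP => x; rewrite -(quot_class_surj x) (afree_sum (repr x)).
rewrite !linear_sum; apply: eq_bigr => J _; rewrite !linearZ.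
by congr (_ *: _); apply: e; exact/asboolP/(valP J).
Qed.

Lemma hom_of_family c :
  (forall i I, NS Lam I -> diffop (Ady R A i) (c I) = 0) ->
  compatible Lam c -> admissible_family c ->
  exists psi : homS (Mdir A w Lam),
    forall I, NS Lam I -> psi (ebar A w Lam I) = c I.
Proof.
move=> cA cC cD.
pose f (v : Afree Lam) : dpoly n C :=
  \sum_(J : NS_type Lam) (v J : S) *: (c (val J) : dpoly n C).
have f_lin : linear f.
  move=> a u v; rewrite /f scaler_sumr -big_split /=; apply: eq_bigr => J _.
  by rewrite !ffunE scalerDl scalerA.
have f_estar p I : NS Lam I -> f (p *: estar Lam I) = p *: (c I : dpoly n C).
  move=> /asboolP NI; pose J : NS_type Lam := exist _ I NI.
  rewrite /f (bigD1 J) //= big1 => [|K KJ].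
    by rewrite !ffunE eqxx addr0; congr (_ *: _); exact: mulr1.
  have -> : (p *: estar Lam I) K = 0.
    rewrite !ffunE -[I]/(val J) (inj_eq val_inj) (negbTE KJ); exact: mulr0.
  exact: scale0r.
pose m := GRing.isLinear.Build S (Afree Lam) (dpoly n C) _ f f_lin.
pose fl : {linear Afree Lam -> dpoly n C} := HB.pack f m.
have fG v : Mdir_rel A w v -> fl v = 0.
  case=> [[i [I [NI ->]]]|[I [J [NI NJ ->]]]|[K [NK nK ->]]].
  - by rewrite [LHS]f_estar //; exact: cA.
  - rewrite linearB; apply/eqP; rewrite subr_eq0; apply/eqP.
    by rewrite [LHS]f_estar // [RHS]f_estar //; exact: cC.
  - by rewrite -[estar Lam K]scale1r [LHS]f_estar // scale1r; exact: cD.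
have [g gE] := quot_lift_exists fG.
exists g => I NI; rewrite [LHS]gE -[estar Lam I]scale1r [LHS]f_estar //.
exact: scale1r.
Qed.

End DirectionModule.

(** * Finiteness of the admissible lattices *)

Section CommonDenominator.

Lemma common_denominator m n (M : 'M[rat]_(m, n)) :
  exists D (Z : 'M[int]_(m, n)), (0 < D)%N /\ map_mx intr Z = D%:R *: M.
Proof.
pose D := (\prod_(p : 'I_m * 'I_n) absz (denq (M p.1 p.2)))%N.
exists D, (\matrix_(i, j) (numq (M i j) *
  (\prod_(p | p != (i, j)) absz (denq (M p.1 p.2)))%N%:Z)).
split; first by apply/prodn_gt0 => p; rewrite absz_gt0 denq_eq0.
apply/matrixP => i j; rewrite !mxE /D [in RHS](bigD1 (i, j)) //= natrM rmorphM /=.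
rewrite [RHS]mulrAC; congr (_ * _).
by rewrite numqE -[in LHS]absz_denq mulrC.
Qed.

End CommonDenominator.

Section FiniteIndex.
Variables (R : realType) (d n : nat) (A : 'M[int]_(d, n)) (N : {set 'I_n}).
Local Notation C := R[i].
Hypothesis kerN : forall u, kerZ A u -> (forall j, j \in N -> u j 0 = 0) -> u = 0.

(** The kernel of this matrix consists of the relations that vanish on [N]. *)
Definition stacked : 'M[int]_(d + n, n) :=
  col_mx A (\matrix_(i, j) ((i == j) && (i \in N))%:R).

Lemma stacked_mul (T : pzRingType) (v : 'cV[T]_n) :
  map_mx intr stacked *m v =
  col_mx (map_mx intr A *m v) (\col_j (if j \in N then v j 0 else 0)).
Proof.
rewrite map_col_mx mul_col_mx; congr col_mx; apply/matrixP => j k; rewrite ord1 !mxE.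
rewrite (bigD1 j) //= big1 => [|i ij]; rewrite !mxE.
  by rewrite eqxx /= addr0; case: (j \in N); rewrite ?mul1r ?mul0r.
by rewrite eq_sym (negbTE ij) mul0r.
Qed.

(** The columns are independent over the integers, hence over the rationals, and a
    left inverse over the rationals has a common denominator. *)
Lemma stacked_left_inverse :
  exists D (Z : 'M[int]_(n, d + n)), (0 < D)%N /\ Z *m stacked = D%:R%:M.
Proof.
pose Eq : 'M[rat]_(d + n, n) := map_mx intr stacked.
have inj_int m k : injective (map_mx intr : 'M[int]_(m, k) -> 'M[rat]_(m, k)).
  move=> X Y /matrixP e; apply/matrixP => i j.
  by have := e i j; rewrite !mxE => /eqP; rewrite eqr_int => /eqP.
have ker r : Eq *m r = 0 :> 'cV_(d + n) -> r = 0 :> 'cV_n.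
  move=> Er; have [D [z [D0 zE]]] := common_denominator r.
  have D0' : D%:R != 0 :> rat by rewrite pnatr_eq0 -lt0n.
  suff z0 : z = 0.
    by move/eqP: zE; rewrite z0 map_mx0 eq_sym scaler_eq0 (negbTE D0') => /eqP.
  have : Eq *m map_mx intr z = 0 by rewrite zE -scalemxAr Er scaler0.
  rewrite /Eq stacked_mul -[RHS]col_mx0 => /eq_col_mx[Az Nz].
  apply: kerN => [|j jN].
    by apply: inj_int; rewrite map_mxM Az map_mx0.
  have /matrixP/(_ j 0) := Nz; rewrite !mxE jN => /eqP.
  by rewrite intr_eq0 => /eqP.
have free : row_free Eq^T.
  apply: inj_row_free => v vE; apply: trmx_inj; rewrite trmx0.
  by apply: ker; apply: trmx_inj; rewrite trmx_mul trmxK vE trmx0.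
have [B BE] := row_freeP free.
have [D [Z [D0 ZE]]] := common_denominator B^T.
exists D, Z; split=> //; apply: inj_int.
rewrite map_mxM ZE -scalemxAl -[map_mx _ _]trmxK -trmx_mul BE trmx1.
by rewrite scalemx1 map_scalar_mx rmorph_nat.
Qed.

(** The left inverse of the stacked matrix expresses [D] times [v] through A v = 0
    and the coordinates of [v] in [N], which are integers. *)
Lemma kernel_bounded_denominator : exists2 D : nat, (0 < D)%N &
  forall v : 'cV[C]_n, map_mx intr A *m v = 0 ->
    (forall j, j \in N -> is_int (v j 0)) -> exists z, D%:R *: v = toC R z.
Proof.
have [D [Z [D0 ZE]]] := stacked_left_inverse; exists D => // v vA vN.
have [p pE] : exists p : 'cV[int]_n,
    toC R p = \col_j (if j \in N then v j 0 else 0).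
  have /choice[f fP] j : exists m : int, m%:~R = (if j \in N then v j 0 else 0).
    by case: ifP => [/vN[m ->]|_]; [exists m|exists 0].
  by exists (\col_j f j); apply/matrixP => j k; rewrite !mxE fP.
exists (Z *m col_mx 0 p); rewrite /toC map_mxM map_col_mx map_mx0.
rewrite [map_mx _ p]pE -[0]vA -stacked_mul mulmxA -map_mxM ZE.
by rewrite map_scalar_mx rmorph_nat mul_scalar_mx.
Qed.

End FiniteIndex.

Section FinitelyManyLattices.
Variables (R : realType) (d n : nat) (A : 'M[int]_(d, n)) (beta : 'cV[R[i]]_d).
Variables (w : 'cV[R]_n) (w_generic : Lgeneric A w).
Local Notation C := R[i].
Local Notation lattice := (exp_lattice A beta).
Implicit Types Lam : lattice.

Lemma exp_latticeP Lam : is_exp_lattice A beta Lam.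
Proof. exact/asboolP/(valP Lam). Qed.

Definition int_coords (gamma : 'cV[C]_n) : {set 'I_n} :=
  finset (fun j => `[< is_int (gamma j 0) >]).

Lemma int_coordsP (gamma : 'cV[C]_n) j : reflect (is_int (gamma j 0)) (j \in int_coords gamma).
Proof. by rewrite inE; exact: asboolP. Qed.

Definition base_point Lam : 'cV[C]_n := xget 0 (expset Lam).

Lemma base_pointP Lam : expset Lam (base_point Lam).
Proof.
have [lam _ LE] := exp_latticeP Lam; apply: (@xgetI _ _ _ lam).
by rewrite LE; exists 0; [rewrite /kerZ /= mulmx0|rewrite toC0 addr0].
Qed.

Lemma exp_lattice_eq Lam Lam' gamma gamma' u :
  expset Lam gamma -> expset Lam' gamma' ->
  kerZ A u -> gamma' = gamma + toC R u -> Lam = Lam'.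
Proof.
have sub (L L' : lattice) g g' v : expset L g -> expset L' g' -> kerZ A v ->
    g' = g + toC R v -> expset L `<=` expset L'.
  move=> Lg Lg' vA gE h Lh.
  have [x xA ->] := lattice_diff (exp_latticeP L) Lg Lh.
  have -> : g + toC R x = g' + toC R (x - v).
    by rewrite gE toCB addrACA subrr addr0.
  by apply: (lattice_shift (exp_latticeP L')) => //; exact/kerZD/kerZN.
move=> Lg Lg' uA e; apply: val_inj; apply/seteqP; split; first exact: sub e.
by apply: (sub _ _ _ _ (- u) Lg' Lg); [exact: kerZN|rewrite toCN e addrK].
Qed.

(** A vector of [L] that vanishes at the integral coordinates of a lattice
    preserves all its strata, in both directions; boundedness then forces its
    weight to be zero. *)
Lemma adm_lattice_kernel Lam u : adm_lattice w Lam -> kerZ A u ->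
  (forall j, j \in int_coords (base_point Lam) -> u j 0 = 0) -> u = 0.
Proof.
move=> [I [_ bI]] uA u0; have [[gamma sg] _] := bI; have [Lg _] := sg.
have LP := exp_latticeP Lam.
have gu j (m : int) : gamma j 0 = m%:~R -> u j 0 = 0.
  move=> gE; apply: u0; apply/int_coordsP.
  have [v _ e] := lattice_diff LP Lg (base_pointP Lam).
  by rewrite e !mxE is_intD gE; exists m.
have pos v : kerZ A v -> (forall j (m : int), gamma j 0 = m%:~R -> v j 0 = 0) ->
    0 <= weight w v.
  move=> vA v0; apply: (recession_weight_ge0 LP bI sg vA) => j m /v0 ->.
  by case: ifP.
apply/eqP; apply: contraT => un0; have := w_generic uA un0.
rewrite -/(weight w u); suff -> : weight w u = 0 by rewrite eqxx.
have wN : weight w (- u) = - weight w u.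
  have w0 : weight w 0 = 0 by rewrite /weight big1 // => j _; rewrite mxE mulr0.
  by rewrite -[- u]sub0r weightB w0 sub0r.
apply/eqP; rewrite eq_le pos // andbT -oppr_ge0 -wN.
apply: pos; first exact: kerZN.
by move=> j m /gu e; rewrite mxE e oppr0.
Qed.

Lemma finite_set_inj (T : Type) (F : finType) (X : set T) (f : T -> F) :
  (forall x y, X x -> X y -> f x = f y -> x = y) -> finite_set X.
Proof.
move=> fi; pose g x := if `[< X x >] then Some (f x) else None.
have -> : X = g @^-1` [set o | o].
  by apply/seteqP; split=> x; rewrite /g /=; case: asboolP.
apply: finite_preimage => [x y|]; last exact: finite_finset.
by rewrite !inE /g /=; case: asboolP => // Xx _; case: asboolP => // Xy _ [/fi ->].
Qed.

(** Among the lattices with a given set of integral coordinates, the class modulo L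
    is recorded by the residues modulo the denominator [D] of [D] times the
    difference with one of them. *)
Lemma finite_adm_lattice : finite_set [set Lam : lattice | adm_lattice w Lam].
Proof.
have -> : [set Lam : lattice | adm_lattice w Lam] =
    \bigcup_(N in [set: {set 'I_n}])
      [set Lam : lattice | adm_lattice w Lam /\ int_coords (base_point Lam) = N].
  apply/seteqP; split=> [Lam aL|Lam [N _ []//]].
  by exists (int_coords (base_point Lam)).
apply: bigcup_finite => // N _.
have [[Lam0 [a0 N0]]|empty] := pselect (exists Lam : lattice,
    adm_lattice w Lam /\ int_coords (base_point Lam) = N); last first.
  rewrite (_ : [set Lam | _] = set0) //; apply/seteqP; split=> // Lam LN.
  by apply: empty; exists Lam.
have kerN u : kerZ A u -> (forall j, j \in N -> u j 0 = 0) -> u = 0.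
  by rewrite -N0; exact: adm_lattice_kernel.
have [D D0 DP] := kernel_bounded_denominator R kerN.
have /choice[z zP] Lam : exists z : 'cV[int]_n,
    int_coords (base_point Lam) = N ->
    D%:R *: (base_point Lam - base_point Lam0) = toC R z.
  have [e|ne] := eqVneq (int_coords (base_point Lam)) N; last first.
    by exists 0 => e; rewrite e eqxx in ne.
  have [||z zE] := DP (base_point Lam - base_point Lam0).
  - rewrite mulmxBr (lattice_eq (exp_latticeP Lam) (base_pointP Lam)).
    by rewrite (lattice_eq (exp_latticeP Lam0) (base_pointP Lam0)) subrr.
  - move=> j jN; have := jN; rewrite -{1}e => /int_coordsP[m mE].
    move: jN; rewrite -N0 => /int_coordsP[m0 m0E].
    by exists (m - m0); rewrite !mxE mE m0E intrB.
  by exists z.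
case: D D0 DP zP => // D _ _ zP.
pose zc Lam j : int := z Lam j 0.
pose F Lam : {ffun 'I_n -> 'I_D.+1} :=
  [ffun j => inord (absz (zc Lam j %% D.+1%:Z)%Z)].
apply: (@finite_set_inj _ _ _ F) => L L' [_ NL] [_ NL'] /ffunP FE.
have D0 : D.+1%:R != 0 :> C by rewrite pnatr_eq0.
have zD j : exists q : int, zc L' j = zc L j + q * D.+1%:Z.
  have := congr1 val (FE j); rewrite !ffunE /= !inordK; first last.
  - by have := @ltz_pmod (zc L j) D.+1%:Z; have := @modz_ge0 (zc L j) D.+1%:Z; lia.
  - by have := @ltz_pmod (zc L' j) D.+1%:Z; have := @modz_ge0 (zc L' j) D.+1%:Z; lia.
  move=> e; exists ((zc L' j %/ D.+1%:Z)%Z - (zc L j %/ D.+1%:Z)%Z).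
  have e' : (zc L j %% D.+1%:Z)%Z = (zc L' j %% D.+1%:Z)%Z.
    have := @modz_ge0 (zc L j) D.+1%:Z; have := @modz_ge0 (zc L' j) D.+1%:Z; lia.
  have e1 := divz_eq (zc L' j) D.+1%:Z; have e2 := divz_eq (zc L j) D.+1%:Z.
  by rewrite mulrBl; lia.
have [q qP] := choice zD; pose u : 'cV[int]_n := \col_j q j.
have bE : base_point L' = base_point L + toC R u.
  apply: (scalerI D0); apply: (addrI (- (D.+1%:R *: base_point Lam0))).
  rewrite scalerDr addrA ![- _ + _]addrC -!scalerBr !zP //.
  apply/matrixP => i k; rewrite ord1 !mxE -![z _ i 0]/(zc _ i) qP intrD intrM.
  by rewrite [D.+1%:R * _]mulrC.
apply: (exp_lattice_eq (base_pointP L) (base_pointP L') _ bE).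
apply: (@toC_inj R d); rewrite toC0 /toC map_mxM.
have := lattice_eq (exp_latticeP L') (base_pointP L').
rewrite bE mulmxDr (lattice_eq (exp_latticeP L) (base_pointP L)) => /eqP.
by rewrite -subr_eq0 addrAC subrr add0r => /eqP.
Qed.

End FinitelyManyLattices.

(** * Directed solutions on one lattice *)

Section DirectedSolutions.
Variables (R : realType) (d n : nat) (A : 'M[int]_(d, n)) (w : 'cV[R]_n).
Local Notation C := R[i].
Local Notation S := {mpoly C[n]}.
Variables (beta : 'cV[C]_d) (Lam : set 'cV[C]_n).
Hypothesis LamP : is_exp_lattice A beta Lam.
Implicit Types (c : {set 'I_n} -> S) (phi : series n C).

Definition directed phi := phi = 0 \/
  exists2 gamma0, Supp phi gamma0 & forall gamma, Supp phi gamma -> le_dir w gamma0 gamma.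

Lemma le_dirE lambda gamma gamma' : Lam lambda -> Lam gamma -> Lam gamma' ->
  le_dir w gamma gamma' <->
  complex.Re (wdot w (gamma - lambda)) <= complex.Re (wdot w (gamma' - lambda)).
Proof.
move=> Ll Lg Lg'; have [u _ ->] := lattice_diff LamP Ll Lg.
have [v _ ->] := lattice_diff LamP Ll Lg'.
rewrite ![lambda + _]addrC !addrK !wdot_toC /= -subr_ge0 -weightB.
by rewrite -(le_dir_shift w (toC R u + lambda)) toCB addrAC addrCA subrr addr0.
Qed.

(** The support is the union of the strata on which [c] does not vanish, and by
    compatibility the set of these is closed under passing to smaller strata. *)
Lemma directed_admissible lambda phi c : Lam lambda -> Supp phi `<=` Lam ->
  normalized Lam lambda phi c -> compatible Lam c ->
  directed phi <-> admissible_family w Lam c.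
Proof.
move=> Ll phiL cE cC.
have suppE gamma : Lam gamma -> Supp phi gamma <-> c (nsupp gamma) != 0.
  move=> Lg; have e := normalized_eq0 LamP Ll cE Lg.
  by split; apply: contra_neq => /e.
split=> [phi_dir K NK nK|cD]; last first.
  have [|phi0] := eqVneq phi 0; [by left|right].
  pose X K : set 'cV[C]_n := [set gamma | stratum Lam K gamma /\ c K != 0].
  have [] := @bigcup_has_minimum R {set 'I_n} _ X
      (fun gamma => complex.Re (wdot w (gamma - lambda))) _ _.
  - move=> K [g [sg cK]]; have NK : NS Lam K by exists g.
    have bK : bounded_dir w Lam K.
      have [[_ h]|nK] := pselect (adm_dir w Lam K); first exact: h.
      by rewrite (cD K NK nK) eqxx in cK.
    have [g1 s1 min1] := stratum_has_minimum LamP bK.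
    exists g1 => // y [sy _].
    by apply/(le_dirE Ll s1.1 sy.1)/min1.
  - apply: contrapT => noX; move/eqP: phi0; apply; apply/funext => g.
    apply/eqP; apply: contraT => pg; exfalso; apply: noX; exists (nsupp g), g.
    by split; [split=> //; exact: phiL|apply/suppE => //; exact: phiL].
  move=> g [K [[Lg gK] cK]] gmin; exists g; first by apply/suppE; rewrite ?gK.
  move=> h sh; have Lh := phiL _ sh; apply/(le_dirE Ll Lg Lh)/gmin.
  by exists (nsupp h); split=> //; exact/suppE.
apply/eqP; apply: contra_notT nK => cK; split=> // J NJ JK; split=> //.
have cJ : c J != 0.
  apply: contraNneq cK => cJ0; have := cC _ _ NJ NK.
  rewrite cJ0 diffop0r (_ : J :\: K = finset.set0)%SET; last first.
    by apply/eqP; rewrite finset.setD_eq0.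
  by rewrite /dmon big_set0 diffop1 => <-.
have suppJ g : stratum Lam J g -> Supp phi g.
  by move=> [Lg gJ]; apply/suppE; rewrite ?gJ.
case: phi_dir => [phi0|[g0 sg0 gmin]].
  by case: NJ => g /suppJ; rewrite /Supp /= phi0 eqxx.
exists g0; first exact: phiL.
by exists 0 => g /suppJ /gmin; rewrite /le_dir rmorph0.
Qed.

(** A minimal negative support below an admissible one is bounded, hence gives an
    element of [min_dir]. *)
Lemma adm_dir_min I : adm_dir w Lam I -> min_dir w Lam !=set0.
Proof.
move=> [NI h]; pose P J := `[< NS Lam J >].
have [J /minsetP[/asboolP NJ Jmin] JI] : {J | minset P J & J \subset I}.
  by apply: minset_exists; exact/asboolP.
exists J; split; last exact: h.
by split=> // K NK KJ; apply: Jmin => //; exact/asboolP.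
Qed.

Lemma nonadm_hom (psi : homS (Mdir A w Lam)) : ~ (min_dir w Lam !=set0) -> psi = 0.
Proof.
move=> nmin; apply: hom_ext => I NI.
have [_ _ cD] := family_of_hom psi.
by apply: cD => // /adm_dir_min.
Qed.

Lemma sol_dirP lambda phi : Lam lambda ->
  sol_dir A beta w Lam phi <->
  Supp phi `<=` Lam /\ exists c, [/\ normalized Lam lambda phi c,
    forall i I, NS Lam I -> diffop (Ady R A i) (c I) = 0,
    compatible Lam c & admissible_family w Lam c].
Proof.
move=> Ll; split=> [[_ phiL phiH phiD]|[phiL [c [cE cA cC cD]]]].
  split=> //; have /(hyp_ideal_lattice LamP phiL)[ht he] := phiH.
  have [c cE] := normalized_exists LamP Ll ht; exists c.
  have cC : compatible Lam c by exact/(normalized_compatible LamP Ll cE).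
  split=> // [i|]; first by apply/(normalized_Ady LamP Ll _ cE) => g; exact: he.
  exact/(directed_admissible Ll phiL cE cC).
split=> //.
- move=> g /phiL Lg; exists g => //; exists 0; by rewrite toC0 addr0.
- apply/(hyp_ideal_lattice LamP phiL); split.
    exact/(normalized_compatible LamP Ll cE).
  by move=> i; apply/(normalized_Ady LamP Ll _ cE) => I; exact: cA.
- exact/(directed_admissible Ll phiL cE cC).
Qed.

Lemma nonadm_sol_dir phi : ~ (min_dir w Lam !=set0) -> sol_dir A beta w Lam phi ->
  phi = 0.
Proof.
move=> nmin sphi; have [lam _ LE] := LamP.
have Ll : Lam lam.
  by rewrite LE; exists 0; [rewrite /kerZ /= mulmx0|rewrite toC0 addr0].
have /(sol_dirP _ Ll)[phiL [c [cE _ _ cD]]] := sphi.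
apply/funext => g; have [Lg|nL] := pselect (Lam g); last first.
  by apply/eqP; apply: contra_notT nL => /phiL.
apply/(normalized_eq0 LamP Ll cE Lg); apply: cD => [|/adm_dir_min//].
by exists g.
Qed.

Section SeriesMap.
Variables (lambda : 'cV[C]_n) (Ll : Lam lambda).
Implicit Types psi : homS (Mdir A w Lam).

Lemma Ser_normalized psi :
  normalized Lam lambda (Ser lambda psi) (fun I => psi (ebar A w Lam I)).
Proof.
move=> gamma Lg; rewrite /Ser (asboolT Lg); apply: op_invK.
exact: (ntransit_unit LamP).
Qed.

Lemma Ser_out psi gamma : ~ Lam gamma -> Ser lambda psi gamma = 0.
Proof. by move=> nL; rewrite /Ser asboolF. Qed.

Lemma Ser_unique psi phi : Supp phi `<=` Lam ->
  normalized Lam lambda phi (fun I => psi (ebar A w Lam I)) -> Ser lambda psi = phi.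
Proof.
move=> phiL cE; apply/funext => gamma.
have [Lg|nL] := pselect (Lam gamma); last first.
  by rewrite Ser_out //; apply/esym/eqP; apply: contra_notT nL => /phiL.
apply: (diffop_inj (ntransit_unit LamP Lg Ll)).
exact: etrans (Ser_normalized psi Lg) (esym (cE _ Lg)).
Qed.

Lemma Ser_supp psi : Supp (Ser lambda psi) `<=` Lam.
Proof.
move=> gamma; rewrite /Supp /=; apply: contra_neqP => nL; exact: Ser_out.
Qed.

Lemma Ser_linear : linear (fun psi : homS (Mdir A w Lam) => Ser lambda psi).
Proof.
move=> a psi psi'; apply: Ser_unique => [gamma|gamma Lg].
  rewrite /Supp /=; apply: contra_neqP => nL.
  have -> : (a *: Ser lambda psi + Ser lambda psi') gamma =
    a *: Ser lambda psi gamma + Ser lambda psi' gamma by [].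
  by rewrite !Ser_out // scaler0 addr0.
have -> : (a *: Ser lambda psi + Ser lambda psi') gamma =
  a *: Ser lambda psi gamma + Ser lambda psi' gamma by [].
rewrite [LHS]diffopDr [X in X + _ = _]diffopZr.
rewrite [X in _ *: X + _ = _](Ser_normalized psi Lg).
rewrite [X in _ + X = _](Ser_normalized psi' Lg).
by rewrite -[X in X + _ = _]diffopZr -[LHS]diffopDr.
Qed.

Lemma Ser_bij : set_bij [set: homS (Mdir A w Lam)] (sol_dir A beta w Lam)
  (fun psi => Ser lambda psi).
Proof.
split.
- move=> psi _; apply/(sol_dirP _ Ll); split; first exact: Ser_supp.
  have [cA cC cD] := family_of_hom psi.
  by exists (fun I => psi (ebar A w Lam I)); split=> //; exact: Ser_normalized.
- move=> psi psi' _ _ e; apply: hom_ext => I [gamma [Lg <-]].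
  apply: (diffop_inj (ntransit_unit LamP Ll Lg)).
  apply: etrans (esym (Ser_normalized psi Lg)) _.
  by rewrite e; exact: Ser_normalized.
- move=> phi /(sol_dirP _ Ll)[phiL [c [cE cA cC cD]]].
  have [psi psiE] := hom_of_family cA cC cD.
  exists psi => //; apply: Ser_unique => // gamma Lg.
  rewrite cE // psiE //; by exists gamma.
Qed.

End SeriesMap.

End DirectedSolutions.

(** * Direct sums *)

Section DirectSumMaps.
Variables (T : pzRingType) (I : choiceType) (M : I -> lmodType T) (W : lmodType T).
Implicit Types x : dsum M.

Lemma dsum_inj_in i (m : M i) : dsum_inj m i = m.
Proof. by rewrite /= /dsum_inj_val dfwith_in. Qed.

Lemma dsum_inj_out i j (m : M i) : i != j -> dsum_inj m j = 0.
Proof. by move=> ij; rewrite /= /dsum_inj_val dfwith_out. Qed.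

Lemma dsum_decomposition x :
  exists s : seq I, x = \sum_(i <- s) dsum_inj (x i).
Proof.
have /asboolP/finite_seqP[s sE] := dsum_fin x; exists (undup s).
apply: dsumP => j; rewrite (big_morph (fun y : dsum M => y j) (id1 := 0) (op1 := +%R)) //.
have out i : i != j -> dsum_inj (x i) j = 0 by exact: dsum_inj_out.
have [js|js] := boolP (j \in undup s).
  rewrite (bigD1_seq j) ?undup_uniq //= big1 ?addr0 => [|i ij]; last exact: out.
  exact/esym/dsum_inj_in.
rewrite big_seq big1 => [|i iS]; last first.
  by apply: out; apply: contraNneq js => <-.
apply/eqP; apply: contraNT js => xj; rewrite mem_undup.
by have : [set i | x i != 0] j by []; rewrite sE.
Qed.

Lemma dsum_linear_ext (f g : {linear dsum M -> W}) :
  (forall i (m : M i), f (dsum_inj m) = g (dsum_inj m)) -> f =1 g.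
Proof.
move=> fg x; have [s ->] := dsum_decomposition x.
by rewrite !linear_sum; apply: eq_bigr => i _; exact: fg.
Qed.

(** Only finitely many components are prescribed, so that their sum is defined on
    the whole direct sum. *)
Lemma dsum_glue (s : seq I) (f : forall i, {linear M i -> W}) : uniq s ->
  exists g : {linear dsum M -> W},
    forall i (m : M i), i \in s -> g (dsum_inj m) = f i m.
Proof.
move=> us; pose g x := \sum_(i <- s) f i (x i).
have g_lin : linear g.
  move=> a x y; rewrite /g scaler_sumr -big_split /=; apply: eq_bigr => i _.
  exact: linearP.
pose m := GRing.isLinear.Build T (dsum M) W _ g g_lin.
pose gl : {linear dsum M -> W} := HB.pack g m.
exists gl => i x iS.
transitivity (\sum_(j <- s) f j (dsum_inj x j)) => //.
rewrite (bigD1_seq i) //= big1 ?addr0 => [|j ji].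
  by congr (f i _); exact: dsum_inj_in.
have -> : dsum_inj_val x j = 0 by apply: dsum_inj_out; rewrite eq_sym.
exact: linear0.
Qed.

End DirectSumMaps.

(** * The isomorphisms *)

Theorem theorem6p3 (R : realType) (d n : nat) (A : 'M[int]_(d, n))
    (rankA : \rank (map_mx intr A : 'M[rat]_(d, n)) = d)
    (beta : 'cV[R[i]]_d)
    (w : 'cV[R]_n) (w_generic : Lgeneric A w)
    (lam : exp_lattice A beta -> 'cV[R[i]]_n)
    (lam_in : forall Lam, adm_lattice w Lam -> expset Lam (lam Lam)) :
  [/\ finite_set [set Lam : exp_lattice A beta | adm_lattice w Lam],
      forall Lam : exp_lattice A beta, adm_lattice w Lam ->
        linear_iso_onto
          (fun psi : homS (Mdir A w Lam) => Ser (lam Lam) psi)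
          (sol_dir A beta w Lam),
      linear_iso_onto
        (fun Psi : homS (Mdir_all A beta w) => Ser_all lam Psi)
        (sol_dir_all A beta w) &
      forall (Lam : exp_lattice A beta) (psi : homS (Mdir A w Lam)),
        adm_lattice w Lam ->
        (forall I gamma, stratum Lam I gamma ->
           Ser (lam Lam) psi gamma =
           op_inv (ntransit (lam Lam) gamma)
                  (ntransit gamma (lam Lam) *: psi (ebar A w Lam I))) /\
        (forall gamma, ~ expset Lam gamma -> Ser (lam Lam) psi gamma = 0)].
Proof.
have adm_fin := finite_adm_lattice beta w_generic.
have LP := @exp_latticeP R d n A beta.
have iso Lam : adm_lattice w Lam -> linear_iso_onto
    (fun psi : homS (Mdir A w Lam) => Ser (lam Lam) psi) (sol_dir A beta w Lam).
  move=> /lam_in Ll; split; [exact: (@Ser_linear R d n A w beta Lam (LP Lam) (lam Lam) Ll)|].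
  exact: (@Ser_bij R d n A w beta Lam (LP Lam) (lam Lam) Ll).
have restrP (Psi : homS (Mdir_all A beta w)) Lam : adm_lattice w Lam ->
    Ser_all lam Psi Lam = Ser (lam Lam) (restr Lam Psi).
  by move=> aL; rewrite /Ser_all (asboolT aL).
have restr0 (Psi : homS (Mdir_all A beta w)) Lam : ~ adm_lattice w Lam -> Ser_all lam Psi Lam = 0.
  by move=> aL; rewrite /Ser_all asboolF.
split; [exact: adm_fin|exact: iso| |]; last first.
  move=> Lam psi aL; split=> [I gamma [Lg <-]|gamma]; first by rewrite /Ser asboolT.
  exact: Ser_out.
split=> [a Psi Psi'|].
  apply/funext => Lam.
  have -> : (a *: Ser_all lam Psi + Ser_all lam Psi') Lam =
    a *: Ser_all lam Psi Lam + Ser_all lam Psi' Lam by [].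
  have [aL|nL] := pselect (adm_lattice w Lam); last first.
    by rewrite !restr0 // scaler0 addr0.
  rewrite !restrP // -(iso Lam aL).1; congr (Ser _ _).
  exact: homSP.
split.
- move=> Psi _; split=> [Lam|].
    have [aL|nL] := pselect (adm_lattice w Lam).
      by rewrite restrP //; have [_ [+ _ _]] := iso Lam aL; apply.
    have supp0 X : Supp (0 : series n R[i]) `<=` X.
      by move=> g; rewrite /Supp /= eqxx.
    rewrite restr0 //; split; [exact: supp0|exact: supp0| |by left].
    by move=> P _; exact: weyl_act0r.
  apply: sub_finite_set adm_fin => Lam /=; apply: contra_neqP => nL; exact: restr0.
- move=> Psi Psi' _ _ e.
  have e' (Lam : exp_lattice A beta) : restr Lam Psi = restr Lam Psi'.
    have [aL|nL] := pselect (adm_lattice w Lam); last first.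
      exact: etrans (nonadm_hom _ nL) (esym (nonadm_hom _ nL)).
    have [_ [_ inj _]] := iso Lam aL; apply: inj; [exact: mem_set|exact: mem_set|].
    by apply: etrans (esym (restrP Psi Lam aL)) _; rewrite e; exact: restrP.
  have agree (Lam : exp_lattice A beta) (m : Mdir A w Lam) :
    restr Lam Psi m = restr Lam Psi' m by rewrite e'.
  by apply: homSP; apply: dsum_linear_ext => Lam m; exact: agree.
- move=> Phi [PhiS _]; have [s sE] := (finite_seqP _).1 adm_fin.
  pose p (Lam : exp_lattice A beta) : homS (Mdir A w Lam) :=
    xget 0 [set psi | Ser (lam Lam) psi = Phi Lam].
  have [Psi PsiE] := dsum_glue p (undup_uniq s).
  exists Psi => //; apply/funext => Lam.
  have [aL|nL] := pselect (adm_lattice w Lam); last first.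
    exact: etrans (restr0 Psi Lam nL) (esym (nonadm_sol_dir (LP Lam) nL (PhiS Lam))).
  rewrite [LHS](restrP Psi Lam aL) (_ : restr Lam Psi = p Lam); last first.
    apply: homSP => m; apply: PsiE; rewrite mem_undup.
    by have : [set Lam : exp_lattice A beta | adm_lattice w Lam] Lam by []; rewrite sE.
  have [_ [_ _ surj]] := iso Lam aL.
  have [psi _ psiE] := surj _ (PhiS Lam).
  exact: (@xgetI _ 0 [set psi | Ser (lam Lam) psi = Phi Lam] psi psiE).
Qed.
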